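(* Let $\alpha\ge1$ and consider on the mesh $\mathcal M$ with cells $\{\mathcal I_k\}$ the scheme for the cell averages $$\bar{\mathbf U}_k^{n+1}=\bar{\mathbf U}_k^n-\frac{\Delta t_n}{|\mathcal I_k|}\sum_{j\in\mathcal N_k}|\mathcal E_{kj}|\,\hat{\mathbf F}_{kj},\qquad \hat{\mathbf F}_{kj}=\sum_{\mu=1}^Q\omega_\mu\,\hat{\mathbf F}\big(\mathbf U_k^n(\mathbf x_{kj}^{(\mu)}),\mathbf U_j^n(\mathbf x_{kj}^{(\mu)});\boldsymbol\xi_{kj}\big),$$ with the Lax–Friedrichs type flux $$\hat{\mathbf F}(\mathbf U,\tilde{\mathbf U};\boldsymbol\xi)=\tfrac12\Big(\langle\boldsymbol\xi,\mathbf F(\mathbf U)+\mathbf F(\tilde{\mathbf U})\rangle-\alpha(\tilde{\mathbf U}-\mathbf U)\Big),$$ where $\mathbf U_k^n(\mathbf x)$ is a vector of polynomials on $\mathcal I_k$ with cell average $\bar{\mathbf U}_k^n$. Suppose the polynomial vectors $\{\mathbf U_k^n(\mathbf x)\}$ satisfy $$\mathrm{div}_k\mathbf B^n:=\sum_{j\in\mathcal N_k}\Big[\sum_{\mu=1}^Q\omega_\mu\Big\langle\boldsymbol\xi_{kj},\tfrac12\big(\mathbf B_k^n(\mathbf x_{kj}^{(\mu)})+\mathbf B_j^n(\mathbf x_{kj}^{(\mu)})\big)\Big\rangle\Big]|\mathcal E_{kj}|=0,\quad\forall k,$$ $$\mathbf U_k^n(\mathbf x_{kj}^{(\mu)})\in\mathcal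 G,\quad\forall\mu\in\{1,\dots,Q\},\ \forall j\in\mathcal N_k,\ \forall k,$$ and that there exists a constant $\beta_k\in(0,\frac12)$ for all $k$ such that $$\mathbf W_k^n:=\frac{1}{1-2\beta_k}\Big[\bar{\mathbf U}_k^n-\frac{2\beta_k}{\sum_{j\in\mathcal N_k}|\mathcal E_{kj}|}\sum_{j\in\mathcal N_k}|\mathcal E_{kj}|\Big(\sum_{\mu=1}^Q\omega_\mu\mathbf U_k^n(\mathbf x_{kj}^{(\mu)})\Big)\Big]\in\mathcal G .$$ Then under the CFL type condition $$0<\frac{\alpha\Delta t_n}{2|\mathcal I_k|}\sum_{j\in\mathcal N_k}|\mathcal E_{kj}|<\beta_k,$$ the solution $\bar{\mathbf U}_k^{n+1}$ of the scheme belongs to $\mathcal G$.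
   Context: Units are such that the speed of light is $c=1$; $\mathbb R^+=(0,\infty)$; $d\in\{2,3\}$. Equation of state (EOS): the specific enthalpy is a function $h=h(p,\rho)$, differentiable on $\mathbb R^+\times\mathbb R^+$, satisfying for all $p,\rho>0$ (i) $h(p,\rho)\ge\sqrt{1+p^2/\rho^2}+p/\rho$; (ii) $h\big(\tfrac1\rho-\tfrac{\partial h}{\partial p}\big)<\tfrac{\partial h}{\partial\rho}<0$; (iii) $\lim_{p\to0^+}h(p,\rho)=1$ for each fixed $\rho>0$. Conservative variables: given $\rho>0$, $p>0$, $\mathbf v\in\mathbb R^3$ with $|\mathbf v|<1$, $\mathbf B\in\mathbb R^3$, put $W=(1-|\mathbf v|^2)^{-1/2}$, $h=h(p,\rho)$, $p_m=\frac12\big(W^{-2}|\mathbf B|^2+(\mathbf v\cdot\mathbf B)^2\big)$, $p_{tot}=p+p_m$, and $$D=\rho W,\quad \mathbf m=\rho hW^2\mathbf v+|\mathbf B|^2\mathbf v-(\mathbf v\cdot\mathbf B)\mathbf B,\quad E=\rho hW^2-p_{tot}+|\mathbf B|^2,\quad \mathbf U=(D,\mathbf m,\mathbf B,E)^\top\in\mathbb R^8.$$ The admissible state set $\mathcal G\subset\mathbb R^8$ is the set of all $\mathbf U$ obtained in this way (i.e. $\rho(\mathbf U)>0$, $p(\mathbf U)>0$, $|\mathbf v(\mathbf U)|<1$). Fluxes: for $\mathbf U\in\mathcal G$ and $\ell=1,\dots,d$, with $\mathbf e_\ell$ the $\ell$-th row of the $3\times3$ identity matrix, $$\mathbf F_\ell(\mathbf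 U)=\Big(Dv_\ell,\ v_\ell\mathbf m-B_\ell\big(W^{-2}\mathbf B+(\mathbf v\cdot\mathbf B)\mathbf v\big)+p_{tot}\mathbf e_\ell,\ v_\ell\mathbf B-B_\ell\mathbf v,\ m_\ell\Big)^\top.$$ For $\boldsymbol\xi\in\mathbb R^d$: $\langle\boldsymbol\xi,\mathbf B\rangle=\sum_{\ell=1}^d\xi_\ell B_\ell$ and $\langle\boldsymbol\xi,\mathbf F(\mathbf U)\rangle=\sum_{\ell=1}^d\xi_\ell\mathbf F_\ell(\mathbf U)$ (extended linearly to sums of fluxes). Mesh: the $d$-dimensional spatial domain is divided into cells $\mathcal I_k$ that are non-self-intersecting $d$-polytopes (possibly unstructured). $\mathcal N_k$ is the index set of neighboring cells of $\mathcal I_k$; for $j\in\mathcal N_k$, $\mathcal E_{kj}=\partial\mathcal I_k\cap\partial\mathcal I_j$ is the common (flat) edge/face, and $\boldsymbol\xi_{kj}\in\mathbb R^d$ is its unit normal pointing from $\mathcal I_k$ to $\mathcal I_j$; $\partial\mathcal I_k$ is the union of the $\mathcal E_{kj}$, $j\in\mathcal N_k$. $|\mathcal I_k|$ and $|\mathcal E_{kj}|$ are the $d$- and $(d-1)$-dimensional Hausdorff measures. $\Delta t_n>0$ is the time step. Approximate solution: $\mathbf U_k^n(\mathbf x)=(D_k^n(\mathbf x),\mathbf m_k^n(\mathbf x),\mathbf B_k^n(\mathbf x),E_k^n(\mathbf x))^\top$ is a vector of polynomials of degree $K$ on $\mathcal I_k$ whose average over $\mathcal I_k$ equals $\bar{\mathbf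 U}_k^n$. $\{\mathbf x_{kj}^{(\mu)}\}_{\mu=1}^Q$ are quadrature nodes on $\mathcal E_{kj}$ (the same nodes for $\mathcal E_{jk}$) with associated positive weights $\{\omega_\mu\}$, $\sum_{\mu=1}^Q\omega_\mu=1$; the rule is exact for polynomials of degree up to $K$ on $\mathcal E_{kj}$. *)

(* Defs.v *)
From HB Require Import structures.
From mathcomp Require Import all_boot all_order all_algebra finmap.
From mathcomp Require Import all_classical all_reals all_analysis.
From mathcomp Require mpoly.

Set Implicit Arguments.
Unset Strict Implicit.
Unset Printing Implicit Defensive.

Import Order.TTheory GRing.Theory Num.Theory.
Import numFieldNormedType.Exports.

Local Open Scope classical_set_scope.
Local Open Scope ring_scope.

(** * Euclidean structure *)

(* The library norm on row vectors is the sup norm, hence [enorm]. *)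
Definition dot (R : realType) n (u v : 'rV[R]_n) : R := \sum_i u 0 i * v 0 i.

Definition enorm (R : realType) n (u : 'rV[R]_n) : R := Num.sqrt (dot u u).

(** * Hausdorff measure *)

Section hausdorff_measure.
Context {R : realType} {n : nat}.
Local Notation T := 'rV[R]_n.
Implicit Types (A : set T) (s : nat) (e : R).
Local Open Scope ereal_scope.

(* With 0 adjoined, the diameter of the empty set is 0. *)
Definition diam A : \bar R :=
  ereal_sup (0 |` [set (enorm (x - y))%:E | x in A & y in A]).

(* Volume of the Euclidean unit ball of R^s. *)
Fixpoint unit_ball_volume s : R :=
  match s with
  | 0%N => 1%R
  | 1%N => 2%R
  | s'.+2 => (2 * pi / s%:R * unit_ball_volume s')%R
  end.

(* Volume of an s-dimensional ball of diameter [diam A]; with this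
   normalization the n-dimensional Hausdorff measure on R^n is the Lebesgue
   measure. *)
Definition hausdorff_weight s A : \bar R :=
  if A == set0 then 0 else (unit_ball_volume s / 2 ^+ s)%:E * diam A ^+ s.

Definition hausdorff_cover e A : set (set T)^nat :=
  [set F | (forall k, diam (F k) <= e%:E) /\ A `<=` \bigcup_k F k].

Definition hausdorff_pre s e A : \bar R :=
  ereal_inf [set \sum_(k <oo) hausdorff_weight s (F k)
            | F in hausdorff_cover e A].

Definition hausdorff s A : \bar R :=
  ereal_sup [set hausdorff_pre s e A | e in [set e | (0 < e)%R]].

Lemma unit_ball_volume_ge0 s : (0 <= unit_ball_volume s)%R.
Proof.
suff: (0 <= unit_ball_volume s)%R /\ (0 <= unit_ball_volume s.+1)%R by case.
elim: s => [|s [ih1 ih2]]; first by [].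
split=> //.
change (0 <= 2 * pi / s.+2%:R * unit_ball_volume s)%R.
by rewrite !mulr_ge0 ?pi_ge0 ?invr_ge0.
Qed.

Lemma diam_ge0 A : 0 <= diam A.
Proof. by apply: ereal_sup_ubound; left. Qed.

Lemma diam0 : diam set0 = 0.
Proof.
apply/eqP; rewrite eq_le diam_ge0 andbT; apply: ge_ereal_sup => x [-> //|].
by move=> [y].
Qed.

Lemma hausdorff_weight_ge0 s A : 0 <= hausdorff_weight s A.
Proof.
rewrite /hausdorff_weight; case: ifP => // _.
rewrite mule_ge0 ?expe_ge0 ?diam_ge0// lee_fin divr_ge0 ?exprn_ge0//.
exact: unit_ball_volume_ge0.
Qed.

Lemma hausdorff_pre_ge0 s e A : 0 <= hausdorff_pre s e A.
Proof.
apply: le_ereal_inf_tmp => _ [F _ <-]; apply: nneseries_ge0 => k _ _.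
exact: hausdorff_weight_ge0.
Qed.

Lemma hausdorff_pre0 s e : (0 < e)%R -> hausdorff_pre s e set0 = 0.
Proof.
move=> e0; apply/eqP; rewrite eq_le hausdorff_pre_ge0 andbT.
apply: ereal_inf_lbound; exists (fun=> set0).
  by split=> // k; rewrite diam0 lee_fin ltW.
by apply: eseries0 => k _ _; rewrite /hausdorff_weight eqxx.
Qed.

Lemma le_hausdorff_pre s e : {homo hausdorff_pre s e : A B / A `<=` B >-> A <= B}.
Proof.
move=> A B AB; apply: ereal_inf_le_tmp => _ [F [dF BF] <-].
by exists F => //; split=> //; apply: subset_trans BF.
Qed.

Lemma hausdorff_pre_sigma_subadditive s e :
  sigma_subadditive (hausdorff_pre s e).
Proof.
move=> A; have [[i ioo]|] := pselect (exists i, hausdorff_pre s e (A i) = +oo).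
  rewrite (eseries_pinfty _ _ ioo) ?leey// => m _.
  by rewrite -ltNye (lt_le_trans _ (hausdorff_pre_ge0 _ _ _)).
rewrite -forallNE => Aoo.
suff add2e (r : {posnum R}) : hausdorff_pre s e (\bigcup_m A m) <=
    \sum_(i <oo) hausdorff_pre s e (A i) + r%:num%:E.
  by apply/lee_addgt0Pr => _/posnumP[].
rewrite (le_trans _ (epsilon_trick _ _ _))//; last first.
  by move=> m; exact: hausdorff_pre_ge0.
pose P m (B : (set T)^nat) := hausdorff_cover e (A m) B /\
  \sum_(k <oo) hausdorff_weight s (B k) <=
  hausdorff_pre s e (A m) + (r%:num / (2 ^ m.+1)%:R)%:E.
have [G PG] : {G : ((set T)^nat)^nat & forall m, P m (G m)}.
  apply: (@choice _ _ P) => m; rewrite /P /hausdorff_pre.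
  set S := (X in ereal_inf X); move infS : (ereal_inf S) => iS.
  case: iS infS => [t Sr|Soo|Soo].
  - have en1 : (0 < r%:num / (2 ^ m.+1)%:R)%R by [].
    have /(lb_ereal_inf_adherent en1) : ereal_inf S \is a fin_num by rewrite Sr.
    move=> [x [B BA muBx] xS].
    by exists B; split => //; rewrite muBx -Sr; exact/ltW.
  - by have := Aoo m; rewrite /hausdorff_pre Soo.
  - by have := hausdorff_pre_ge0 s e (A m); rewrite /hausdorff_pre -/S Soo.
have wG_ge0 x : 0 <= (hausdorff_weight s \o uncurry G) x.
  exact: hausdorff_weight_ge0.
apply: (@le_trans _ _ (\esum_(i in setT) (hausdorff_weight s \o uncurry G) i)).
  apply: ereal_inf_lbound => /=.
  have /card_esym/ppcard_eqP[f] := card_nat2.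
  exists (uncurry G \o f).
    split => [i|].
      by rewrite /= /uncurry; case: (f i) => a b; exact: (PG a).1.1.
    apply: (@subset_trans _  (\bigcup_m \bigcup_k G m k)) => [t [i _]|].
      by move=> /((PG i).1.2) -[j _ ?]; exists i => //; exists j.
    move=> t [i _ [j _ Bijt]]; exists (f^-1%FUN (i, j)) => //=.
    by rewrite invK ?inE.
  rewrite -(esum_pred_image (hausdorff_weight s \o uncurry G) _ xpredT)
    ?[fun=> _]set_true//.
  by rewrite image_eq.
rewrite (_ : esum _ _ =
    \sum_(i <oo) \sum_(j <oo) hausdorff_weight s (G i j)); last first.
  pose J : nat -> set (nat * nat) := fun i => [set (i, j) | j in setT].
  rewrite (_ : setT = \bigcup_k J k); last first.
    by rewrite predeqE => -[a b]; split => // _; exists a => //; exists b.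
  rewrite esum_bigcupT /=; last 2 first.
    - apply/trivIsetP => i j _ _ ij.
      rewrite predeqE => -[l m] /=; split => //= -[] [_] _ [<-{l} _].
      by move=> [m' _] [] /esym/eqP; rewrite (negbTE ij).
    - by move=> /= [l m]; exact: hausdorff_weight_ge0.
  rewrite -(image_id [set: nat]) -fun_true esum_pred_image//; last first.
    by move=> m _; apply: esum_ge0 => z _; exact: hausdorff_weight_ge0.
  apply: eq_eseriesr => /= j _.
  rewrite -(esum_pred_image (hausdorff_weight s \o uncurry G) (pair j) predT)//=.
  - by congr esum; rewrite predeqE => -[a b]; split; move=> [i _ <-]; exists i.
  - by move=> *; exact: hausdorff_weight_ge0.
  - by move=> ? ? _ _; exact: (@can_inj _ _ _ snd).
apply: lee_nneseries => [i _ _|i _]; last exact: (PG i).2.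
by apply: nneseries_ge0 => m *; exact: (wG_ge0 (i, m)).
Qed.

Lemma hausdorff_ge0 s A : 0 <= hausdorff s A.
Proof.
apply: (le_trans (hausdorff_pre_ge0 s 1 A)); apply: ereal_sup_ubound.
by exists 1%R => //=.
Qed.

Lemma hausdorff0 s : hausdorff s set0 = 0.
Proof.
apply/eqP; rewrite eq_le hausdorff_ge0 andbT; apply: ge_ereal_sup => _ [e e0 <-].
by rewrite hausdorff_pre0.
Qed.

Lemma le_hausdorff s : {homo hausdorff s : A B / A `<=` B >-> A <= B}.
Proof.
move=> A B AB; apply: ge_ereal_sup => _ [e e0 <-].
apply: (le_trans (le_hausdorff_pre s e AB)).
by apply: ereal_sup_ubound; exists e.
Qed.

Lemma hausdorff_sigma_subadditive s : sigma_subadditive (hausdorff s).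
Proof.
move=> A; apply: ge_ereal_sup => _ [e e0 <-].
apply: (le_trans (hausdorff_pre_sigma_subadditive s e A)).
apply: lee_nneseries => [i _ _|i _]; first exact: hausdorff_pre_ge0.
by apply: ereal_sup_ubound; exists e.
Qed.

HB.instance Definition _ s := isOuterMeasure.Build R T (hausdorff s)
  (hausdorff0 s) (hausdorff_ge0 s) (@le_hausdorff s)
  (@hausdorff_sigma_subadditive s).

End hausdorff_measure.

(* As a measure, [hausdorff s] lives on its Caratheodory sigma-algebra. *)
Definition hausdorff_integral (R : realType) n s (A : set 'rV[R]_n)
    (f : 'rV[R]_n -> R) : R :=
  let H : {outer_measure set 'rV[R]_n -> \bar R} := hausdorff s in
  Rintegral (H : set (caratheodory_type H) -> \bar R) A f.

Definition hmeas (R : realType) n s (A : set 'rV[R]_n) : R :=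
  fine (hausdorff s A).

Definition average (R : realType) n s (A : set 'rV[R]_n)
    (f : 'rV[R]_n -> R) : R :=
  hausdorff_integral s A f / hmeas s A.

(** * Polytopal meshes *)

Definition boundary (T : topologicalType) (A : set T) : set T :=
  closure A `\` A°.

Definition conv_hull (R : realType) n (s : seq 'rV[R]_n) : set 'rV[R]_n :=
  [set x | exists a : 'I_(size s) -> R, [/\ forall i, 0 <= a i,
     \sum_i a i = 1 & x = \sum_i a i *: s`_i]].

(* A full-dimensional, not necessarily convex polytope: a finite union of
   convex hulls of finite sets.  It is non-self-intersecting when its boundary
   does not touch itself, i.e. close to each of its boundary points it has
   exactly one local piece and so does its complement. *)
Definition polytope (R : realType) n (A : set 'rV[R]_n) : Prop :=
  [/\ exists P : seq (seq 'rV[R]_n), A = \bigcup_(s in [set` P]) conv_hull s,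
      A !=set0, regclosed A & connected A°].

Definition non_self_intersecting (R : realType) n (A : set 'rV[R]_n) : Prop :=
  forall x, boundary A x -> \forall e \near 0^'+,
    connected (A° `&` ball x e) /\ connected (~` A `&` ball x e).

(* [outward A B xi x]: close to x, the set A fills the side of the hyperplane
   through x orthogonal to xi from which xi points away, and B fills the side
   into which xi points. *)
Definition outward (R : realType) n (A B : set 'rV[R]_n) (xi x : 'rV[R]_n) :
    Prop :=
  \forall y \near x, (dot xi (y - x) < 0 -> A y) /\ (0 < dot xi (y - x) -> B y).

(* Since the boundary of each cell is covered by faces shared with neighbours,
   there are no domain boundary faces; the index set may be infinite, so that
   meshes of the whole space and unfolded periodic meshes are covered.
   [normal_outward] leaves out a null set, e.g. the edges of the face. *)
Record mesh (R : realType) (d : nat) := Mesh {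
  index :> choiceType ;
  cell : index -> set 'rV[R]_d ;
  nbr : index -> {fset index} ;
  normal : index -> index -> 'rV[R]_d ;
  face := fun k j => boundary (cell k) `&` boundary (cell j) ;
  cell_polytope : forall k,
    polytope (cell k) /\ non_self_intersecting (cell k) ;
  cell_disjoint : forall k j, k != j -> (cell k)° `&` (cell j)° = set0 ;
  nbrP : forall k j,
    (j \in nbr k) <-> (j != k /\ (0 < hausdorff d.-1 (face k j))%E) ;
  boundary_cell : forall k,
    boundary (cell k) = \bigcup_(j in [set` nbr k]) face k j ;
  normal_unit : forall k j, j \in nbr k -> enorm (normal k j) = 1 ;
  face_flat : forall k j, j \in nbr k ->
    exists c, forall x, face k j x -> dot (normal k j) x = c ;
  normal_outward : forall k j, j \in nbr k ->
    hausdorff d.-1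
      (face k j `\` [set x | outward (cell k) (cell j) (normal k j) x]) = 0%E }.

Definition vol (R : realType) d (M : mesh R d) (k : M) : R := hmeas d (cell k).

Definition area (R : realType) d (M : mesh R d) (k j : M) : R :=
  hmeas d.-1 (face k j).

(** * Polynomials and quadrature *)

(* Total degree at most K. *)
Definition polynomial_fun (R : realType) d K (f : 'rV[R]_d -> R) : Prop :=
  exists2 P : mpoly.mpoly d R,
    forall m, mpoly.mcoeff m P != 0 -> (mpoly.mdeg m <= K)%N &
    forall x, f x = mpoly.meval (fun i => x 0 i) P.

Record quadrature (R : realType) d (M : mesh R d) (K Q : nat)
    (w : 'I_Q -> R) (x : M -> M -> 'I_Q -> 'rV[R]_d) : Prop := Quadrature {
  weight_gt0 : forall mu, 0 < w mu ;
  weight_sum1 : \sum_mu w mu = 1 ;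
  node_face : forall k j mu, j \in nbr k -> face k j (x k j mu) ;
  node_sym : forall k j mu, j \in nbr k -> x j k mu = x k j mu ;
  quad_exact : forall k j f, j \in nbr k -> polynomial_fun K f ->
    \sum_mu w mu * f (x k j mu) = average d.-1 (face k j) f }.

(** * Relativistic magnetohydrodynamics *)

(* The first argument of [h] is p, the second one is rho. *)
Definition is_eos (R : realType) (h : R -> R -> R) : Prop :=
  [/\ forall p rho : R, 0 < p -> 0 < rho ->
        differentiable (fun z : R * R => h z.1 z.2 : R) (p, rho),
      forall p rho : R, 0 < p -> 0 < rho ->
        Num.sqrt (1 + p ^+ 2 / rho ^+ 2) + p / rho <= h p rho,
      forall p rho : R, 0 < p -> 0 < rho ->
        h p rho * (rho^-1 - derive1 (h ^~ rho) p) < derive1 (h p) rho < 0 &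
      forall rho : R, 0 < rho -> h p rho @[p --> 0^'+] --> (1 : R)].

Section rmhd.
Context {R : realType}.

(* U = (D, m, B, E) in R^8 *)
Definition state := 'rV[R]_(1 + (3 + (3 + 1))).

Definition mkstate (D : R) (m B : 'rV[R]_3) (E : R) : state :=
  row_mx (const_mx D) (row_mx m (row_mx B (const_mx E))).

Definition sD (U : state) : R := lsubmx U 0 0.
Definition sm (U : state) : 'rV[R]_3 := lsubmx (rsubmx U).
Definition sB (U : state) : 'rV[R]_3 := lsubmx (rsubmx (rsubmx U)).

(* Primitive variables (rho, p, v, B). *)
Definition prim := (R * R * 'rV[R]_3 * 'rV[R]_3)%type.

Definition prho (w : prim) : R := w.1.1.1.
Definition pp (w : prim) : R := w.1.1.2.
Definition pv (w : prim) : 'rV[R]_3 := w.1.2.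
Definition pB (w : prim) : 'rV[R]_3 := w.2.

Definition physical (w : prim) : Prop :=
  [/\ 0 < prho w, 0 < pp w & enorm (pv w) < 1].

Definition lorentz (w : prim) : R := (Num.sqrt (1 - dot (pv w) (pv w)))^-1.

Definition pmag (w : prim) : R :=
  2^-1 * ((lorentz w) ^- 2 * dot (pB w) (pB w) + dot (pv w) (pB w) ^+ 2).

Definition ptot (w : prim) : R := pp w + pmag w.

Variable h : R -> R -> R.

Definition cons (w : prim) : state :=
  let rhohW2 := prho w * h (pp w) (prho w) * lorentz w ^+ 2 in
  let B2 := dot (pB w) (pB w) in
  mkstate (prho w * lorentz w)
    (rhohW2 *: pv w + B2 *: pv w - dot (pv w) (pB w) *: pB w)
    (pB w)
    (rhohW2 - ptot w + B2).

Definition admissible : set state := [set cons w | w in physical].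

(* The primitive variables of U, meaningful for U in [admissible]. *)
Definition prim_of (U : state) : prim :=
  xget point [set w | physical w /\ cons w = U].

Definition flux (l : 'I_3) (U : state) : state :=
  let w := prim_of U in
  let v := pv w in
  let B := sB U in
  mkstate (sD U * v 0 l)
    (v 0 l *: sm U - B 0 l *: (lorentz w ^- 2 *: B + dot v B *: v)
      + ptot w *: delta_mx 0 l)
    (v 0 l *: B - B 0 l *: v)
    (sm U 0 l).

(* For d <= 3, [inord] embeds the d space directions among the 3 components
   of vectors. *)
Definition dirB d (xi : 'rV[R]_d) (B : 'rV[R]_3) : R :=
  \sum_(l < d) xi 0 l * B 0 (inord l).

Definition dirF d (xi : 'rV[R]_d) (U : state) : state :=
  \sum_(l < d) xi 0 l *: flux (inord l) U.

Definition lf_flux d (alpha : R) (U V : state) (xi : 'rV[R]_d) : state :=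
  2^-1 *: (dirF xi U + dirF xi V - alpha *: (V - U)).

End rmhd.
Arguments state : clear implicits.

(** * The finite volume scheme *)

Section scheme.
Context {R : realType} {d : nat} (h : R -> R -> R) (M : mesh R d) {Q : nat}.
Variables (w : 'I_Q -> R) (x : M -> M -> 'I_Q -> 'rV[R]_d).
Variable U : M -> 'rV[R]_d -> state R.

Definition cell_average (k : M) : state R :=
  \row_i average d (cell k) (fun y => U k y 0 i).

Definition perimeter (k : M) : R := \sum_(j <- nbr k) area k j.

Definition num_flux (alpha : R) (k j : M) : state R :=
  \sum_(mu < Q) w mu *:
    lf_flux h alpha (U k (x k j mu)) (U j (x k j mu)) (normal k j).

Definition next_average (alpha dt : R) (Ubar : M -> state R) (k : M) : state R :=
  Ubar k - (dt / vol k) *: \sum_(j <- nbr k) area k j *: num_flux alpha k j.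

Definition divB (k : M) : R :=
  \sum_(j <- nbr k)
    (\sum_(mu < Q) w mu * dirB (normal k j)
       (2^-1 *: (sB (U k (x k j mu)) + sB (U j (x k j mu))))) * area k j.

Definition inner_state (Ubar : M -> state R) (beta : M -> R) (k : M) : state R :=
  (1 - 2 * beta k)^-1 *: (Ubar k - (2 * beta k / perimeter k) *:
    \sum_(j <- nbr k) area k j *: \sum_(mu < Q) w mu *: U k (x k j mu)).

End scheme.

(* Main.v *)
(* A state (D, m, B, E) is admissible iff D > 0 and
     U . n(u,C) + p(u,C) > 0   for all u, C in R^3 with |u| < 1,
   where n(u,C) = (-sqrt(1-|u|^2), -u, -(1-|u|^2) C - (u.C) u, 1) and p(u,C) is
   the magnetic pressure of (u, C).  These conditions are affine in U, so that
   it suffices to write the new average as a convex combination.  Its flux terms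
   satisfy the inequality only up to u p(u,C) - B (u.C), in the direction of the
   normal: the first term sums to 0 because the boundary of a cell is a closed
   surface, the second one because the discrete divergence vanishes.

   The flux inequality splits into a hydrodynamic part, which is a Doppler
   bound, and a magnetic part, which is the dominant energy condition for the
   difference of the fields (B, -v x B) and (C, -u x C).  Conversely, under the
   conditions, a Z with Z = rho h W^2 exists by the intermediate value theorem.

   For the closed surface, let e be a direction transverse to all faces.  Along
   almost every line parallel to e the faces are crossed alternately inwards and
   outwards, and H^(d-1) of a face times |xi . e| is H^(d-1) of its projection
   along e.  The latter follows, up to isometries, from the behaviour of H^(d-1)
   on R^(d-1) when one coordinate is stretched, which is a consequence of the
   uniqueness of translation-invariant measures. *)
From HB Require Import structures.
Require Import Defs.
From mathcomp Require Import all_boot all_order all_algebra finmap.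
From mathcomp Require Import all_classical all_reals all_analysis.
From mathcomp Require Import perm measurable_realfun ring lra.

Set Implicit Arguments.
Unset Strict Implicit.
Unset Printing Implicit Defensive.

Import Order.TTheory GRing.Theory Num.Theory.
Import numFieldNormedType.Exports.

Local Open Scope classical_set_scope.
Local Open Scope ring_scope.

(** * Euclidean vectors and the dominant energy condition *)

(** Velocity and pressure have no closed form in U, which is why admissibility is traded for
    conditions affine in U. For fixed u such a condition is quadratic in C and strongest at C = B,
    so the converse works with that case. The difficulty there is that [h] is controlled at positive
    pressure only: the intermediate value theorem has to run beyond the last zero of the recovered
    pressure.

    The flux inequality allows any direction of length at most 1. The scheme uses - normal / alpha,
    which qualifies because alpha is at least the speed of light. Both states at a node are paired
    with the same direction, so that their extra terms add up to the two-sided mean of B in the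
    discrete divergence; positivity is reached only for the mean over the whole cell boundary.

    Cells may be nonconvex, hence the count of entries and exits along lines. The lines through
    points where a face is not outward form a null set that is not known to be Borel, so the
    integration over lines takes place on the Caratheodory sigma-algebra. *)

Section dot_product.
Context {R : realType} {n : nat}.
Implicit Types (u v w : 'rV[R]_n) (a : R).

Lemma dotC u v : dot u v = dot v u.
Proof. by apply: eq_bigr => i _; rewrite mulrC. Qed.

Lemma dotDl u v w : dot (u + v) w = dot u w + dot v w.
Proof. by rewrite /dot -big_split; apply: eq_bigr => i _; rewrite mxE mulrDl. Qed.

Lemma dotZl a u v : dot (a *: u) v = a * dot u v.
Proof. by rewrite /dot mulr_sumr; apply: eq_bigr => i _; rewrite mxE mulrA. Qed.

Lemma dotDr u v w : dot w (u + v) = dot w u + dot w v.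
Proof. by rewrite dotC dotDl !(dotC w). Qed.

Lemma dotZr a u v : dot u (a *: v) = a * dot u v.
Proof. by rewrite dotC dotZl dotC. Qed.

Lemma dotNl u v : dot (- u) v = - dot u v.
Proof. by rewrite -scaleN1r dotZl mulN1r. Qed.

Lemma dotNr u v : dot u (- v) = - dot u v.
Proof. by rewrite dotC dotNl dotC. Qed.

Lemma dot0l v : dot 0 v = 0.
Proof. by rewrite -(scale0r 0) dotZl mul0r. Qed.

Lemma dot_suml I (r : seq I) (P : pred I) (F : I -> 'rV[R]_n) v :
  dot (\sum_(i <- r | P i) F i) v = \sum_(i <- r | P i) dot (F i) v.
Proof.
by elim/big_rec2: _ => [|i x y _ <-]; rewrite ?dot0l ?dotDl.
Qed.

Lemma dotvv_ge0 u : 0 <= dot u u.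
Proof. by apply: sumr_ge0 => i _; rewrite -expr2 sqr_ge0. Qed.

Lemma dotvv_eq0 u : (dot u u == 0) = (u == 0).
Proof.
apply/idP/eqP => [|->]; last by rewrite dot0l.
rewrite psumr_eq0 => [/allP u0|i _]; last by rewrite -expr2 sqr_ge0.
apply/rowP => i; have /implyP/(_ isT) := u0 i (mem_index_enum i).
by rewrite mulf_eq0 orbb mxE => /eqP.
Qed.

Definition dotE := (dotDl, dotDr, dotNl, dotNr, dotZl, dotZr).

Lemma cauchy_schwarz_dot u v : dot u v ^+ 2 <= dot u u * dot v v.
Proof.
have [/eqP|v0] := eqVneq (dot v v) 0.
  by rewrite dotvv_eq0 => /eqP ->; rewrite dotC !dot0l mulr0 expr0n.
have vgt0 : 0 < dot v v by rewrite lt_neqAle eq_sym v0 dotvv_ge0.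
have := dotvv_ge0 (dot v v *: u - dot u v *: v).
rewrite !dotE (dotC v u).
rewrite [leRHS](_ : _ = dot v v * (dot u u * dot v v - dot u v ^+ 2)); last by ring.
by rewrite pmulr_rge0// subr_ge0.
Qed.

(** In Minkowski space (1, -u) and (a, v) are future-directed causal vectors, so their product a +
    u.v is nonnegative. Causality enters the proof in this form. *)
Lemma dot_geN u v a : dot u u <= 1 -> 0 <= a -> dot v v <= a ^+ 2 ->
  - a <= dot u v.
Proof.
move=> u1 a0 va; rewrite lerNl; have [uv0|uv0] := leP 0 (dot u v).
  by apply: le_trans a0; rewrite oppr_le0.
rewrite -ler_sqr ?nnegrE// ?oppr_ge0 ?(ltW uv0)// sqrrN.
apply: le_trans (cauchy_schwarz_dot u v) _.
rewrite -[leRHS]mul1r; apply: ler_pM => //; exact: dotvv_ge0.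
Qed.

End dot_product.

Section row3.
Context {R : realType}.
Implicit Types (u v E B xi : 'rV[R]_3).

Lemma dot3E u v : dot u v = u 0 (inord 0) * v 0 (inord 0) +
  u 0 (inord 1) * v 0 (inord 1) + u 0 (inord 2) * v 0 (inord 2).
Proof.
rewrite /dot !big_ord_recl big_ord0 addr0 addrA.
by congr (_ + _ + _); congr (_ * _); congr (fun_of_matrix _ _ _);
  apply: val_inj; rewrite /= inordK.
Qed.

(** Indices go through [inord], as in [dot3E], so that vector identities become polynomial
    identities in the components. *)
Definition cross u v : 'rV[R]_3 := \row_i
  if (i == 0 :> nat) then u 0 (inord 1) * v 0 (inord 2) - u 0 (inord 2) * v 0 (inord 1)
  else if (i == 1 :> nat) then u 0 (inord 2) * v 0 (inord 0) - u 0 (inord 0) * v 0 (inord 2)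
  else u 0 (inord 0) * v 0 (inord 1) - u 0 (inord 1) * v 0 (inord 0).

Lemma cross0 u v : cross u v 0 (inord 0) =
  u 0 (inord 1) * v 0 (inord 2) - u 0 (inord 2) * v 0 (inord 1).
Proof. by rewrite mxE inordK. Qed.

Lemma cross1 u v : cross u v 0 (inord 1) =
  u 0 (inord 2) * v 0 (inord 0) - u 0 (inord 0) * v 0 (inord 2).
Proof. by rewrite mxE inordK. Qed.

Lemma cross2 u v : cross u v 0 (inord 2) =
  u 0 (inord 0) * v 0 (inord 1) - u 0 (inord 1) * v 0 (inord 0).
Proof. by rewrite mxE inordK. Qed.

(* The electromagnetic stress-energy tensor maps the causal vector (1, v) to a
   future-directed causal vector: J below is its spatial part and e - S.v its
   time part. *)
Lemma dominant_energy xi v E B (e := 2^-1 * (dot E E + dot B B))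
    (S := cross E B) : dot xi xi <= 1 -> dot v v <= 1 ->
  0 <= e * (1 - dot xi v) + dot S (xi - v) + dot xi E * dot E v + dot xi B * dot B v.
Proof.
move=> xi1 v1.
(* Up to constants, the two squares added to |S|^2 are the Lorentz invariants of the field. *)
have eS : dot S S + (2^-1 * (dot E E - dot B B)) ^+ 2 + dot E B ^+ 2 = e ^+ 2.
  by rewrite /e /S !dot3E !cross0 !cross1 !cross2; field.
have e0 : 0 <= e by rewrite /e mulr_ge0 ?addr_ge0 ?dotvv_ge0.
have Se : dot S S <= e ^+ 2.
  by rewrite -eS -addrA lerDl addr_ge0 ?sqr_ge0.
pose J := S - e *: v + dot E v *: E + dot B v *: B.
have J0 : 0 <= e - dot S v.
  rewrite subr_ge0; have := @dot_geN _ _ (- v) S e.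
  by rewrite !dotE opprK lerN2 dotC => /(_ v1 e0 Se).
have JJ : dot J J <= (e - dot S v) ^+ 2.
  rewrite -subr_ge0.
  (* The square of the electromagnetic stress-energy tensor is a multiple of the identity, so the
     tensor multiplies every Minkowski norm by the same factor e^2 - |S|^2. *)
  have -> : (e - dot S v) ^+ 2 - dot J J = (e ^+ 2 - dot S S) * (1 - dot v v).
    rewrite /J !dotE /e /S !dot3E !cross0 !cross1 !cross2.
    by field.
  by rewrite mulr_ge0 ?subr_ge0.
have := dot_geN xi1 J0 JJ.
rewrite -subr_ge0 opprK; congr (0 <= _).
rewrite /J !dotE (dotC S xi).
ring.
Qed.

End row3.

(** * The hydrodynamic part *)

Section hydro.
Context {R : realType} {n : nat}.
(** [s] stands for the energy density rho h - p, while [q] and [q'] are the inverse Lorentz factors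
    of v and u. *)
Variables (rho p s q q' : R) (xi v u : 'rV[R]_n).
Hypotheses (rho0 : 0 < rho) (p0 : 0 < p) (s0 : 0 <= s).
Hypothesis srhop : rho ^+ 2 + p ^+ 2 <= s ^+ 2.
Hypotheses (q0 : 0 < q) (qv : q ^+ 2 = 1 - dot v v).
Hypotheses (q'0 : 0 < q') (q'u : q' ^+ 2 = 1 - dot u u).

(** G / (q q') is the Lorentz factor of the relative velocity of u and v, and r / (q q') is that
    factor times the relative speed. *)
Let G := 1 - dot v u.
Let r := Num.sqrt (G ^+ 2 - (q * q') ^+ 2).

Let dist2 : dot (v - u) (v - u) = 2 * G - q ^+ 2 - q' ^+ 2.
Proof. by rewrite qv q'u !dotE /G (dotC u v); ring. Qed.

Let Gq : q * q' <= G.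
Proof. by have := dotvv_ge0 (v - u); have := sqr_ge0 (q - q'); rewrite dist2; nra. Qed.

Let G0 : 0 < G. Proof. exact: lt_le_trans (mulr_gt0 q0 q'0) Gq. Qed.

Let r2 : r ^+ 2 = G ^+ 2 - (q * q') ^+ 2.
Proof.
rewrite sqr_sqrtr// subr_ge0 ler_sqr// nnegrE; first exact/ltW/mulr_gt0.
exact/ltW.
Qed.

Let r0 : 0 <= r. Proof. exact: sqrtr_ge0. Qed.

(** Cauchy-Schwarz in the plane for (rho, p) and (q q', r), the latter vector having length G. *)
Let s_bound : rho * (q * q') + p * r <= s * G.
Proof.
rewrite -ler_sqr ?nnegrE; first last.
- by rewrite mulr_ge0// ltW.
- by rewrite addr_ge0 ?mulr_ge0// ltW.
have : (rho * (q * q') + p * r) ^+ 2 + (rho * r - p * (q * q')) ^+ 2 =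
    (rho ^+ 2 + p ^+ 2) * G ^+ 2.
  rewrite -[G ^+ 2](subrK ((q * q') ^+ 2)) -r2; ring.
have : (rho ^+ 2 + p ^+ 2) * G ^+ 2 <= s ^+ 2 * G ^+ 2 by rewrite ler_wpM2r// sqr_ge0.
have := sqr_ge0 (rho * r - p * (q * q')).
rewrite exprMn; lra.
Qed.

(** This form of r^2 shows that q^2 - G <= r, strictly unless u = v. *)
Let r_q2 : (q ^+ 2 - G) ^+ 2 + q ^+ 2 * dot (v - u) (v - u) = r ^+ 2.
Proof. by rewrite dist2 r2; ring. Qed.

Let Grq : 0 <= G + r - q ^+ 2.
Proof.
suff : q ^+ 2 - G <= r by lra.
have [|/ltW qG] := leP (q ^+ 2 - G) 0; first by move/le_trans; apply.
by rewrite -ler_sqr ?nnegrE// -r_q2 lerDl mulr_ge0 ?sqr_ge0// dotvv_ge0.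
Qed.

(* (G + r) (1, v) - q^2 (1, u) is a future-directed null vector, whose product
   with the causal vector (1, -xi) is therefore nonnegative: this is the
   relativistic Doppler bound on (1 + xi.u) / (1 + xi.v). *)
Let doppler : dot xi xi <= 1 ->
  q ^+ 2 * (1 + dot xi u) <= (1 + dot xi v) * (G + r).
Proof.
move=> xi1.
pose N := (G + r) *: v - q ^+ 2 *: u.
have NN : dot N N = (G + r - q ^+ 2) ^+ 2.
  apply/eqP; rewrite -subr_eq0 /N !dotE (dotC u v).
  have -> : dot v v = 1 - q ^+ 2 by rewrite qv; ring.
  have -> : dot u u = 1 - q' ^+ 2 by rewrite q'u; ring.
  have -> : dot v u = 1 - G by rewrite /G; ring.
  apply/eqP.
  transitivity (q ^+ 2 * (G ^+ 2 - (q * q') ^+ 2 - r ^+ 2)); last by rewrite r2; ring.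
  ring.
have := dot_geN xi1 Grq (eq_ind_r (fun x => x <= _) (lexx _) NN).
rewrite /N !dotE; lra.
Qed.

(** Multiplied by p, the Doppler bound leaves p (G + r) to be estimated, and [s_bound] absorbs p r
    into s G - rho q q'. *)
Lemma hydro_flux_ge0 : dot xi xi <= 1 ->
  p * q ^+ 2 * (1 + dot xi u) <=
  (1 + dot xi v) * ((p + s) * (1 - dot v u) - rho * (q * q')).
Proof.
move=> xi1.
have X0 : 0 <= 1 + dot xi v.
  have := @dot_geN _ _ xi v 1 xi1 ler01; rewrite expr1n.
  by have := sqr_ge0 q; rewrite qv; lra.
rewrite -mulrA; apply: le_trans (ler_wpM2l (ltW p0) (doppler xi1)) _.
rewrite mulrCA; apply: ler_wpM2l => //.
by have := s_bound; rewrite -/G; lra.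
Qed.

(** The strict form of the case xi = 0. For u different from v strictness comes from q^2 - G < r;
    for u = v it comes from rho < s. *)
Lemma hydro_gt0 : p * q ^+ 2 < (p + s) * (1 - dot v u) - rho * (q * q').
Proof.
rewrite -/G; have := s_bound => sb.
have [uv|uv] := eqVneq (v - u) 0.
  have vu : v = u by apply/eqP; rewrite -subr_eq0 uv.
  have qq : q' = q by apply/eqP; rewrite -(eqrXn2 (ltn0Sn 1)) ?ltW// qv q'u vu.
  have GE : G = q ^+ 2 by rewrite qv /G -vu.
  rewrite GE qq -expr2.
  have rs : rho < s.
    rewrite -ltr_sqr ?nnegrE// ?(ltW rho0)//; apply: lt_le_trans srhop.
    by rewrite ltrDl exprn_gt0.
  rewrite [ltRHS](_ : _ = p * q ^+ 2 + (s - rho) * q ^+ 2); last by ring.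
  by rewrite ltrDl mulr_gt0 ?subr_gt0// exprn_gt0.
have d0 : 0 < dot (v - u) (v - u) by rewrite lt_neqAle dotvv_ge0 eq_sym dotvv_eq0 uv.
have : q ^+ 2 - G < r.
  have [|/ltW qG] := leP (q ^+ 2 - G) 0.
    move=> /le_lt_trans; apply; rewrite lt_neqAle r0 andbT eq_sym -sqrf_eq0 -r_q2.
    by rewrite gt_eqF// ltr_wpDl ?sqr_ge0// mulr_gt0// exprn_gt0.
  by rewrite -ltr_sqr ?nnegrE// -r_q2 ltrDl mulr_gt0 ?exprn_gt0.
move=> H; have : p * q ^+ 2 < p * (G + r) by rewrite ltr_pM2l//; lra.
lra.
Qed.

End hydro.

(** * The linear functionals *)

Section state_components.
Context {R : realType}.
Implicit Types (U V : state R) (a : R).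

Definition sE U : R := rsubmx (rsubmx (rsubmx U)) 0 0.

Lemma sD_mk D m B E : sD (mkstate D m B E) = D :> R.
Proof. by rewrite /sD /mkstate row_mxKl mxE. Qed.

Lemma sm_mk (D : R) m B E : sm (mkstate D m B E) = m.
Proof. by rewrite /sm /mkstate row_mxKr row_mxKl. Qed.

Lemma sB_mk (D : R) m B E : sB (mkstate D m B E) = B.
Proof. by rewrite /sB /mkstate !row_mxKr row_mxKl. Qed.

Lemma sE_mk D m B E : sE (mkstate D m B E) = E :> R.
Proof. by rewrite /sE /mkstate !row_mxKr mxE. Qed.

Lemma mkstateK U : mkstate (sD U) (sm U) (sB U) (sE U) = U.
Proof.
have const_hd (A : 'M[R]_1) : const_mx (A 0 0) = A.
  by apply/matrixP => i j; rewrite mxE !ord1.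
by rewrite /mkstate /sD /sm /sB /sE !const_hd !hsubmxK.
Qed.

Lemma sD_linear a U V : sD (a *: U + V) = a * sD U + sD V.
Proof. by rewrite /sD !mxE. Qed.

Lemma sm_linear a U V : sm (a *: U + V) = a *: sm U + sm V.
Proof. by rewrite /sm !linearP. Qed.

Lemma sB_linear a U V : sB (a *: U + V) = a *: sB U + sB V.
Proof. by rewrite /sB !linearP. Qed.

Lemma sE_linear a U V : sE (a *: U + V) = a * sE U + sE V.
Proof. by rewrite /sE !mxE. Qed.

HB.instance Definition _ := GRing.isLinear.Build R (state R) R _ sD sD_linear.
HB.instance Definition _ := GRing.isLinear.Build R (state R) 'rV[R]_3 _ sm sm_linear.
HB.instance Definition _ := GRing.isLinear.Build R (state R) 'rV[R]_3 _ sB sB_linear.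
HB.instance Definition _ := GRing.isLinear.Build R (state R) R _ sE sE_linear.

End state_components.

Section rmhd_functional.
Context {R : realType}.
Implicit Types (u C xi : 'rV[R]_3) (U : state R).

(** A symmetric map of C, positive definite for |u| < 1, whose quadratic form is twice [mag_press].
    Hence [mag_press u C - dot B (mag_mul u C)] is minimal at C = B. *)
Definition mag_mul u C : 'rV[R]_3 := (1 - dot u u) *: C + dot u C *: u.

Definition mag_press u C : R :=
  2^-1 * ((1 - dot u u) * dot C C + dot u C ^+ 2).

(* [U . n(u,C)] *)
Definition normal_form u C U : R :=
  sE U - dot (sm U) u - sD U * Num.sqrt (1 - dot u u) - dot (sB U) (mag_mul u C).

Lemma normal_form_linear u C a U V :
  normal_form u C (a *: U + V) = a * normal_form u C U + normal_form u C V.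
Proof. by rewrite /normal_form !linearP /= !dotE; ring. Qed.

HB.instance Definition _ u C :=
  GRing.isLinear.Build R (state R) R _ (normal_form u C) (normal_form_linear u C).

Variable h : R -> R -> R.
Hypothesis hE : forall p rho : R, 0 < p -> 0 < rho ->
  Num.sqrt (1 + p ^+ 2 / rho ^+ 2) + p / rho <= h p rho.

(** The enthalpy bound multiplied by rho, in the shape required of [s] in the hydrodynamic part. *)
Lemma eos_bound (p rho : R) : 0 < p -> 0 < rho ->
  0 <= rho * h p rho - p /\ rho ^+ 2 + p ^+ 2 <= (rho * h p rho - p) ^+ 2.
Proof.
move=> p0 r0; have := hE p0 r0.
set S := Num.sqrt _ => Sh.
have S0 : 0 <= S by exact: sqrtr_ge0.
have S2 : S ^+ 2 = 1 + p ^+ 2 / rho ^+ 2.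
  by rewrite sqr_sqrtr// addr_ge0// divr_ge0// sqr_ge0.
have rS : rho * S <= rho * h p rho - p.
  have := ler_wpM2l (ltW r0) Sh; rewrite mulrDr [rho * (p / rho)]mulrC divfK ?gt_eqF//.
  lra.
have rS0 : 0 <= rho * S by rewrite mulr_ge0// ltW.
split; first exact: le_trans rS.
have -> : rho ^+ 2 + p ^+ 2 = (rho * S) ^+ 2.
  by rewrite exprMn S2; field; rewrite gt_eqF.
by rewrite ler_sqr ?nnegrE// (le_trans rS0).
Qed.

(** The flux along any vector of R^3, written on primitive variables. This avoids both the choice
    made in [prim_of] and the split into coordinate directions. *)
Definition prim_flux (w : @prim R) xi : state R :=
  let v := pv w in let B := pB w in
  let U := cons h w in
  mkstate (sD U * dot xi v)
    (dot xi v *: sm U - dot xi B *: (lorentz w ^- 2 *: B + dot v B *: v)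
       + ptot w *: xi)
    (dot xi v *: B - dot xi B *: v)
    (dot xi (sm U)).

Lemma physical_vv (w : @prim R) : physical w -> dot (pv w) (pv w) < 1.
Proof.
by case=> _ _; rewrite /enorm => v1; rewrite -ltr_sqrt// sqrtr1.
Qed.

Lemma lorentz_gt0 (w : @prim R) : physical w -> 0 < lorentz w.
Proof. by move/physical_vv => vv; rewrite invr_gt0 sqrtr_gt0 subr_gt0. Qed.

Lemma lorentzN2 (w : @prim R) : physical w -> lorentz w ^- 2 = 1 - dot (pv w) (pv w).
Proof.
move/physical_vv => vv.
by rewrite /lorentz exprVn invrK sqr_sqrtr// subr_ge0 ltW.
Qed.

(** The last group of terms is the expression of [dominant_energy] for the field difference (E',
    B'), with E' = - v x B + u x C; what precedes it is free of magnetic fields. *)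
Lemma normal_form_split (w : @prim R) xi u C : physical w ->
  let v := pv w in let B := pB w in
  let A := prho w * h (pp w) (prho w) * lorentz w ^+ 2 in
  let E' := cross u C - cross v B in
  let B' := B - C in
  normal_form u C (cons h w + prim_flux w xi) + mag_press u C * (1 + dot xi u)
    - dot xi B * dot u C =
  (1 + dot xi v) * (A * (1 - dot v u) -
     prho w * lorentz w * Num.sqrt (1 - dot u u)) - pp w * (1 + dot xi u)
  + (2^-1 * (dot E' E' + dot B' B') * (1 - dot xi u) + dot (cross E' B') (xi - u)
     + dot xi E' * dot E' u + dot xi B' * dot B' u).
Proof.
move=> wp v B A E' B'.
rewrite /normal_form !linearD /= /prim_flux /cons /= !sD_mk !sm_mk !sB_mk !sE_mk.
rewrite -/v -/B -/A lorentzN2// /ptot /pmag lorentzN2// -/v -/B /mag_press /mag_mul.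
set D := prho w * lorentz w; set q := Num.sqrt _; set p := pp w.
(* A, D, q and p lose their values, since the identity is polynomial in them. *)
move: A D q p @E' @B' => A D q p E' B'.
rewrite /E' /B' !dotE !dot3E.
rewrite !(cross0, cross1, cross2, mxE).
by field.
Qed.


Let Lorentz_sqr (w : @prim R) : physical w ->
  let q := Num.sqrt (1 - dot (pv w) (pv w)) in
  0 < q /\ q ^+ 2 = 1 - dot (pv w) (pv w).
Proof.
move=> /physical_vv vv q; rewrite sqrtr_gt0 subr_gt0; split => //.
by rewrite sqr_sqrtr// subr_ge0 ltW.
Qed.

Lemma normal_form_flux_ge0 (w : @prim R) xi u C : physical w ->
  dot xi xi <= 1 -> dot u u < 1 ->
  0 <= normal_form u C (cons h w + prim_flux w xi)
       + mag_press u C * (1 + dot xi u) - dot xi (pB w) * dot u C.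
Proof.
move=> wp xi1 u1; rewrite normal_form_split// addr_ge0//; last first.
  by apply: dominant_energy => //; exact: ltW.
have [q0 q2] := Lorentz_sqr wp; have [rho0 p0 _] := wp.
have [s0 s2] := eos_bound p0 rho0.
have q'0 : 0 < Num.sqrt (1 - dot u u) by rewrite sqrtr_gt0 subr_gt0.
have q'2 : Num.sqrt (1 - dot u u) ^+ 2 = 1 - dot u u.
  by rewrite sqr_sqrtr// subr_ge0 ltW.
have := hydro_flux_ge0 rho0 p0 s0 s2 q0 q2 q'0 q'2 xi1.
rewrite /lorentz; set q := Num.sqrt (1 - dot (pv w) (pv w)).
rewrite -subr_ge0 => H.
(* Here q^-2 is W^2, and rho h is written as p + s with s = rho h - p. *)
rewrite [leRHS](_ : _ = q ^- 2 * ((1 + dot xi (pv w)) *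
  ((pp w + (prho w * h (pp w) (prho w) - pp w)) * (1 - dot (pv w) u) -
  prho w * (q * Num.sqrt (1 - dot u u))) - pp w * q ^+ 2 * (1 + dot xi u))).
  by rewrite mulr_ge0// invr_ge0 sqr_ge0.
by field; rewrite gt_eqF.
Qed.

(** The splitting in the direction xi = 0, where the flux vanishes; the strict sign comes from the
    hydrodynamic part. *)
Lemma normal_form_cons_gt0 (w : @prim R) u C : physical w -> dot u u < 1 ->
  0 < normal_form u C (cons h w) + mag_press u C.
Proof.
move=> wp u1.
have flux0 : prim_flux w 0 = 0.
  rewrite /prim_flux !dot0l !(scale0r, mulr0, subrr, scaler0, addr0).
  by rewrite -[RHS]mkstateK !linear0.
have /= := normal_form_split 0 u C wp; rewrite flux0 addr0 !dot0l mul0r subr0 addr0 mulr1.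
move=> ->; rewrite mul1r mulr1; apply: ltr_wpDr.
  have := dominant_energy (cross u C - cross (pv w) (pB w)) (pB w - C) (xi := 0) (v := u).
  by rewrite !dot0l; apply; rewrite ?ler01// ltW.
have [q0 q2] := Lorentz_sqr wp; have [rho0 p0 _] := wp.
have [s0 s2] := eos_bound p0 rho0.
have q'0 : 0 < Num.sqrt (1 - dot u u) by rewrite sqrtr_gt0 subr_gt0.
have q'2 : Num.sqrt (1 - dot u u) ^+ 2 = 1 - dot u u.
  by rewrite sqr_sqrtr// subr_ge0 ltW.
have := hydro_gt0 rho0 p0 s0 s2 q0 q2 q'0 q'2.
rewrite /lorentz; set q := Num.sqrt (1 - dot (pv w) (pv w)).
rewrite -[X in is_true X -> _]subr_gt0 => H.
rewrite [ltRHS](_ : _ = q ^- 2 *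
  ((pp w + (prho w * h (pp w) (prho w) - pp w)) * (1 - dot (pv w) u) -
  prho w * (q * Num.sqrt (1 - dot u u)) - pp w * q ^+ 2)).
  by rewrite mulr_gt0// invr_gt0 exprn_gt0.
by field; rewrite gt_eqF.
Qed.

Lemma sD_cons_gt0 (w : @prim R) : physical w -> 0 < sD (cons h w).
Proof. by move=> wp; rewrite sD_mk mulr_gt0 ?lorentz_gt0//; case: wp. Qed.

Lemma sD_flux_ge0 (w : @prim R) xi : physical w -> dot xi xi <= 1 ->
  0 <= sD (cons h w + prim_flux w xi).
Proof.
move=> wp xi1; rewrite linearD /= [sD (prim_flux _ _)]sD_mk -[X in X + _]mulr1 -mulrDr.
rewrite mulr_ge0 ?(ltW (sD_cons_gt0 wp))//.
have := @dot_geN _ _ xi (pv w) 1 xi1 ler01; rewrite expr1n ltW ?physical_vv//.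
by move=> /(_ isT); lra.
Qed.

Definition emb3 d (xi : 'rV[R]_d) : 'rV[R]_3 :=
  \sum_(l < d) xi 0 l *: delta_mx 0 (inord l).

Lemma emb3E d (xi : 'rV[R]_d) (B : 'rV[R]_3) : dot (emb3 xi) B = dirB xi B.
Proof.
rewrite /emb3 /dirB dot_suml; apply: eq_bigr => l _; rewrite dotZl; congr (_ * _).
rewrite /dot (bigD1 (inord l))//= big1 ?addr0 ?mxE ?eqxx ?mul1r//.
by move=> i /negbTE il; rewrite mxE il andbF mul0r.
Qed.

(** With d <= 3, [inord] is injective on the d directions, so embedding only pads with zeros. *)
Lemma emb3_unit d (xi : 'rV[R]_d) : (d <= 3)%N -> dot (emb3 xi) (emb3 xi) = dot xi xi.
Proof.
move=> d3; rewrite emb3E; apply: eq_bigr => l _; congr (_ * _).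
rewrite /emb3 summxE (bigD1 l)//= big1 ?addr0 ?mxE ?eqxx ?mulr1// => i il.
rewrite !mxE eqxx /= eq_sym; case: eqP => [/(congr1 val)|]; last by rewrite mulr0.
by rewrite /= !inordK ?(leq_trans (ltn_ord _))// => /val_inj /eqP; rewrite (negbTE il).
Qed.

(** The witness is the preimage chosen by [prim_of], the one through which [flux] is defined. *)
Lemma dirF_prim d (xi : 'rV[R]_d) (U : state R) : admissible h U ->
  exists w : @prim R, [/\ physical w, cons h w = U & dirF h xi U = prim_flux w (emb3 xi)].
Proof.
move=> [w0 w0p w0U].
have [wp wU] : physical (prim_of h U) /\ cons h (prim_of h U) = U.
  exact: (@xgetPex _ point [set w | physical w /\ cons h w = U] (ex_intro _ w0 (conj w0p w0U))).
exists (prim_of h U); split => //.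
rewrite -[LHS]mkstateK /prim_flux wU.
have sBU : pB (prim_of h U) = sB U by rewrite -{2}wU sB_mk.
congr mkstate; rewrite /dirF raddf_sum /= ?emb3E; under eq_bigr do
  rewrite linearZ /= ?sD_mk ?sm_mk ?sB_mk ?sE_mk.
- by rewrite mulr_sumr; apply: eq_bigr => l _; rewrite mulrCA.
- rewrite sBU; move: (dot _ _) => vB; apply/rowP => i; rewrite summxE !mxE /dirB /emb3 summxE !mulr_suml mulr_sumr.
  rewrite -sumrB -big_split /=; apply: eq_bigr => l _; rewrite !mxE; ring.
- rewrite sBU; apply/rowP => i; rewrite summxE !mxE /dirB !mulr_suml.
  rewrite -sumrB; apply: eq_bigr => l _; rewrite !mxE; ring.
- by [].
Qed.

End rmhd_functional.

(** * Recovery of the primitive variables *)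

Section real_analysis.
Context {R : realType}.
Implicit Types f : R -> R.

Lemma IVT_pointwise f (a b v : R) : a <= b ->
  (forall x, a <= x <= b -> {for x, continuous f}) -> f a <= v <= f b ->
  exists2 c, a <= c <= b & f c = v.
Proof.
move=> ab cf /andP[av vb]; have [||c] := @IVT R f a b v ab.
- by apply/continuous_in_subspaceT => x /[!inE]/= xab; apply: cf; rewrite in_itv/= in xab.
- by rewrite ge_min le_max av vb orbT.
- by rewrite in_itv/=; exists c.
Qed.

(** c is the supremum of the points where f <= 0. The positivity on the whole ray beyond c keeps the
    recovered pressure in the domain where [h] is controlled. *)
Lemma last_zero f (a L : R) : f a < 0 ->
  (forall x, a <= x -> {for x, continuous f}) ->
  (forall x, L < x -> 0 < f x) ->
  exists c, [/\ a <= c, f c = 0 & forall x, c < x -> 0 < f x].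
Proof.
move=> fa cf fL.
pose S := [set x | a <= x /\ f x <= 0].
have Sa : S a by split => //; exact: ltW.
have ubS : ubound S L.
  by move=> x [_ fx]; rewrite leNgt; apply/negP => /fL; rewrite ltNge fx.
have supS : has_sup S by split; [exists a | exists L].
have ac : a <= sup S by apply: ub_le_sup => //; exists L.
have pos x : sup S < x -> 0 < f x.
  move=> Sx; rewrite ltNge; apply/negP => fx; move: (Sx); apply/negP; rewrite -leNgt.
  apply: ub_le_sup; first by exists L.
  split => //; apply: ltW; exact: le_lt_trans Sx.
exists (sup S); split => //; have cc := cf _ ac.
apply/eqP; rewrite eq_le; apply/andP; split; rewrite leNgt; apply/negP => fc.
  have [e /= e0 He] : nbhs_ball (sup S) [set x | 0 < f x].
    by apply/nbhs_ballP; exact: (cvgr_gt _ cc).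
  have [x [ax fx] Sx] := sup_adherent e0 supS.
  suff : 0 < f x by rewrite ltNge fx.
  apply: He; rewrite /ball/= ger0_norm ?subr_ge0; last by apply: ub_le_sup; [exists L|].
  by rewrite ltrBlDr -ltrBlDl.
have [e /= e0 He] : nbhs_ball (sup S) [set x | f x < 0].
  by apply/nbhs_ballP; exact: (cvgr_lt _ cc).
have : f (sup S + e / 2) < 0.
  apply: He; rewrite /ball/= opprD addNKr normrN gtr0_norm ?divr_gt0//.
  by rewrite ltr_pdivrMr// ltr_pMr// ltr1n.
by rewrite ltNge ltW// pos// ltrDl divr_gt0.
Qed.
End real_analysis.

Section eos_monotone.
Context {R : realType}.
Variable h : R -> R -> R.
Hypothesis heos : is_eos h.

Lemma eos_continuous (p rho : R) : 0 < p -> 0 < rho -> {for (p, rho), continuous (fun z : R * R => h z.1 z.2)}.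
Proof. by case: heos => hd _ _ _ p0 r0; apply: differentiable_continuous; exact: hd. Qed.

Lemma eos_nincr (p rho rho' : R) : 0 < p -> 0 < rho -> rho <= rho' -> h p rho' <= h p rho.
Proof.
case: heos => hd _ hm _ p0 rho0 rr.
have dh (z : R) : 0 < z -> differentiable (h p : R -> R) z.
  move=> z0.
  have -> : (h p : R -> R) = (fun z : R * R => h z.1 z.2) \o (fun z => (p, z)) by [].
  apply: differentiable_comp; last exact: hd.
  exact: differentiable_pair.
(* The two booleans make the interval closed at both ends. *)
refine (@ler0_derive1_le _ (h p) rho rho' _ _ true false _ rho' rho _ _ rr).
- move=> z; rewrite in_itv/= => /andP[rz _].
  by apply/derivable1_diffP; apply: dh; exact: lt_trans rz.
- move=> z; rewrite in_itv/= => /andP[rz _].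
  by have /andP[_ /ltW] := hm p z p0 (lt_trans rho0 rz).
- apply: continuous_in_subspaceT => z /[!inE]/=; rewrite in_itv/= => /andP[rz _].
  by apply: differentiable_continuous; apply: dh; exact: lt_le_trans rz.
- by rewrite in_itv/= lexx rr.
- by rewrite in_itv/= lexx rr.
Qed.

End eos_monotone.

(* Everything is parametrized by the unknown Z = rho h W^2. *)
Section recovery.
Context {R : realType}.
Variables (D E : R) (m B : 'rV[R]_3).
Implicit Types Z p rho : R.
Hypothesis D0 : 0 < D.
(** The condition of the characterization at C = B, where [dot B (mag_mul u B)] is twice
    [mag_press u B]. *)
Hypothesis pos : forall u, dot u u < 1 ->
  0 < E - dot m u - D * Num.sqrt (1 - dot u u) - mag_press u B.

Local Notation b := (dot B B).
Local Notation g := (dot m B).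

(** Solves m = (Z + b) v - (v.B) B for v: the product with B gives v.B = g / Z. Then [rec_q] is 1 /
    W, and [rec_p] solves the energy equation for p. *)
Definition rec_v (Z : R) : 'rV[R]_3 := (Z + b)^-1 *: (m + (g / Z) *: B).
Definition rec_V2 (Z : R) : R := dot (rec_v Z) (rec_v Z).
Definition rec_q (Z : R) : R := Num.sqrt (1 - rec_V2 Z).
Definition rec_p (Z : R) : R := Z - E + b - mag_press (rec_v Z) B.

Let b0 : 0 <= b. Proof. exact: dotvv_ge0. Qed.

Let Zb_gt0 Z : 0 < Z -> 0 < Z + b. Proof. by move=> ?; exact: ltr_pwDl. Qed.

Lemma rec_vB Z : 0 < Z -> dot (rec_v Z) B = g / Z.
Proof.
move=> Z0; rewrite /rec_v !dotE; field.
by rewrite !gt_eqF// Zb_gt0.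
Qed.

Lemma rec_mE Z : 0 < Z -> m = (Z + b) *: rec_v Z - dot (rec_v Z) B *: B.
Proof.
move=> Z0; rewrite rec_vB// /rec_v scalerA divff ?gt_eqF ?Zb_gt0// scale1r.
by rewrite addrK.
Qed.

Lemma rec_V2E Z : 0 < Z ->
  rec_V2 Z = (dot m m + 2 * g ^+ 2 / Z + g ^+ 2 * b / Z ^+ 2) / (Z + b) ^+ 2.
Proof.
move=> Z0; rewrite /rec_V2 /rec_v !dotE (dotC B m); field.
by rewrite !gt_eqF// Zb_gt0.
Qed.

Lemma rec_V2_nincr Z Z' : 0 < Z -> Z <= Z' -> rec_V2 Z' <= rec_V2 Z.
Proof.
move=> Z0 ZZ'; have Z'0 : 0 < Z' by exact: lt_le_trans ZZ'.
rewrite !rec_V2E//.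
have ZV : Z'^-1 <= Z^-1 by rewrite lef_pV2.
apply: ler_pM.
- by rewrite !(sqr_ge0, addr_ge0, divr_ge0, mulr_ge0, dotvv_ge0)// ltW.
- by rewrite invr_ge0 sqr_ge0.
- rewrite lerD// ?lerD//; first by rewrite ler_wpM2l// mulr_ge0// sqr_ge0.
  apply: ler_wpM2l; first by rewrite mulr_ge0// sqr_ge0.
  by rewrite lef_pV2 ?posrE ?exprn_gt0// ler_sqr ?nnegrE ?(ltW Z0) ?(ltW Z'0).
- rewrite lef_pV2 ?posrE ?exprn_gt0 ?Zb_gt0// ler_sqr ?nnegrE ?lerD2r//;
    by rewrite ltW// Zb_gt0.
Qed.

(** This is the positivity condition at u = v(Z). *)
Lemma rec_p_lt Z : 0 < Z -> rec_V2 Z < 1 ->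
  rec_p Z < rec_q Z * (Z * rec_q Z - D).
Proof.
move=> Z0 V1; have := pos V1; rewrite -/(rec_V2 Z) -/(rec_q Z).
have q2 : rec_q Z ^+ 2 = 1 - rec_V2 Z by rewrite sqr_sqrtr// subr_ge0 ltW.
have -> : rec_q Z * (Z * rec_q Z - D) = Z * (1 - rec_V2 Z) - D * rec_q Z.
  by rewrite -q2; ring.
have -> : dot m (rec_v Z) = (Z + b) * rec_V2 Z - dot (rec_v Z) B ^+ 2.
  rewrite {1}(rec_mE Z0) /rec_V2; move: (rec_v Z) => v.
  by rewrite dotDl dotNl !dotZl (dotC B v).
rewrite /rec_p /mag_press -/(rec_V2 Z).
lra.
Qed.

Lemma rec_p_ge Z : 0 < Z -> rec_V2 Z < 1 -> Z - E <= rec_p Z.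
Proof.
move=> Z0 V1; rewrite /rec_p -addrA lerDl subr_ge0 /mag_press -/(rec_V2 Z).
have := cauchy_schwarz_dot (rec_v Z) B; rewrite -/(rec_V2 Z).
by have := b0; nra.
Qed.

Let cvg_Zb Z : 0 < Z -> (fun z : R => (z + b)^-1) @ Z --> (Z + b)^-1.
Proof.
move=> Z0; apply: cvgV; first by rewrite gt_eqF// Zb_gt0.
by apply: cvgD; [exact: cvg_id|exact: cvg_cst].
Qed.

Let cvg_gZ Z : 0 < Z -> (fun z : R => g / z) @ Z --> g / Z.
Proof.
move=> Z0; apply: cvgM; first exact: cvg_cst.
by apply: cvgV; [rewrite gt_eqF|exact: cvg_id].
Qed.

Lemma continuous_rec_V2 Z : 0 < Z -> {for Z, continuous rec_V2}.
Proof.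
move=> Z0; have cb := cvg_Zb Z0; have cg := cvg_gZ Z0.
have -> : rec_V2 = fun z => (z + b)^-1 * ((z + b)^-1 *
    ((dot m m + g / z * g) + (g / z * g + g / z * (g / z * b)))).
  by apply/funext => z; rewrite /rec_V2 /rec_v !dotE (dotC B m); ring.
apply: (cvgM cb (cvgM cb _)); apply: cvgD.
  by apply: cvgD; [exact: cvg_cst|apply: (cvgM cg); exact: cvg_cst].
by apply: cvgD; [|apply: (cvgM cg)]; apply: (cvgM cg); exact: cvg_cst.
Qed.

Lemma continuous_rec_q Z : 0 < Z -> {for Z, continuous rec_q}.
Proof.
move=> Z0; apply: continuous_cvg; first exact: sqrt_continuous.
by apply: cvgB; [exact: cvg_cst|exact: continuous_rec_V2].
Qed.

Lemma continuous_rec_p Z : 0 < Z -> {for Z, continuous rec_p}.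
Proof.
move=> Z0; have cb := cvg_Zb Z0; have cg := cvg_gZ Z0.
have cvB : (fun z : R => dot (rec_v z) B) @ Z --> dot (rec_v Z) B.
  have -> : (fun z => dot (rec_v z) B) = fun z => (z + b)^-1 * (g + g / z * b).
    by apply/funext => z; rewrite /rec_v !dotE.
  rewrite /rec_v !dotE; apply: (cvgM cb).
  by apply: cvgD; [exact: cvg_cst|apply: (cvgM cg); exact: cvg_cst].
apply: cvgB.
  apply: cvgD; last exact: cvg_cst.
  by apply: cvgB; [exact: cvg_id|exact: cvg_cst].
apply: cvgM; first exact: cvg_cst.
apply: cvgD; last exact: cvgM.
apply: cvgM; last exact: cvg_cst.
by apply: cvgB; [exact: cvg_cst|exact: continuous_rec_V2].
Qed.

(* Z1 is where Z = D W: the enthalpy would be 1 there, and p is negative. *)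
Lemma rec_start : exists Z1, [/\ 0 < Z1, rec_V2 Z1 < 1 & rec_p Z1 < 0].
Proof.
(* [rec_V2 Z * (Z + b) ^+ 2] decreases in Z, so N bounds |v|^2 Z^2 for all Z >= D. Z2 is chosen so
   that Z2^2 - N >= D^2, that is, Z2 q(Z2) >= D. *)
pose N := rec_V2 D * (D + b) ^+ 2.
have N0 : 0 <= N by rewrite mulr_ge0 ?dotvv_ge0// sqr_ge0.
pose Z2 := D + 1 + N.
have DZ2 : D <= Z2 by rewrite /Z2; lra.
have Z20 : 0 < Z2 by exact: lt_le_trans DZ2.
have V2Z2 : rec_V2 Z2 * Z2 ^+ 2 <= N.
  have : rec_V2 Z2 * (Z2 + b) ^+ 2 <= N.
    rewrite /N !rec_V2E// !divfK ?expf_neq0 ?gt_eqF ?Zb_gt0//.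
    have ZV : Z2^-1 <= D^-1 by rewrite lef_pV2.
    rewrite lerD// ?lerD//; first by rewrite ler_wpM2l// mulr_ge0// sqr_ge0.
    apply: ler_wpM2l; first by rewrite mulr_ge0// sqr_ge0.
    by rewrite lef_pV2 ?posrE ?exprn_gt0// ler_sqr ?nnegrE ?(ltW Z20) ?(ltW D0).
  apply: le_trans; apply: ler_wpM2l; first exact: dotvv_ge0.
  by rewrite ler_sqr ?nnegrE ?lerDl// ltW// Zb_gt0.
have qZ2 : D <= Z2 * rec_q Z2.
  rewrite /rec_q -[X in X * _](ger0_norm (ltW Z20)) -sqrtr_sqr -sqrtrM ?sqr_ge0//.
  rewrite -[leLHS](ger0_norm (ltW D0)) -sqrtr_sqr ler_wsqrtr//.
  have : D ^+ 2 + N <= Z2 ^+ 2 by rewrite /Z2; have := D0; have := N0; nra.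
  by rewrite mulrBr mulr1 mulrC; lra.
have qD : D * rec_q D <= D.
  rewrite ger_pMr// /rec_q -[leRHS]sqrtr1 ler_wsqrtr//.
  by rewrite gerBl dotvv_ge0.
have [||Z1 /andP[DZ1 _] Z1q] := @IVT_pointwise _ (fun z => z * rec_q z) D Z2 D DZ2.
- move=> z /andP[Dz _]; have z0 : 0 < z by exact: lt_le_trans Dz.
  by apply: cvgM; [exact: cvg_id|exact: continuous_rec_q].
- by rewrite qD qZ2.
have Z10 : 0 < Z1 by exact: lt_le_trans DZ1.
have q0 : 0 < rec_q Z1 by rewrite -(pmulr_rgt0 _ Z10) Z1q.
have V1 : rec_V2 Z1 < 1 by move: q0; rewrite sqrtr_gt0 subr_gt0.
by exists Z1; split => //; have := rec_p_lt Z10 V1; rewrite Z1q subrr mulr0.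
Qed.

Variable h : R -> R -> R.
Hypothesis heos : is_eos h.

(** With rho = D q, the equation Z = rho h W^2 reads D h(p, D q) = Z q. At the last zero Za of the
    pressure, [rec_p_lt] gives D < Za q, and h tends to 1 as p tends to 0, so the left side is the
    smaller one just beyond Za. For large Z the lower bound on [h] makes it the larger one. *)
Lemma recover_prim : exists2 w, physical w & cons h w = mkstate D m B E.
Proof.
have [_ hE _ hlim] := heos.
have [Z1 [Z10 V1 p1]] := rec_start.
have V2lt Z : Z1 <= Z -> rec_V2 Z < 1.
  by move=> Z1Z; apply: le_lt_trans V1; exact: rec_V2_nincr.
have Zgt0 Z : Z1 <= Z -> 0 < Z by exact: lt_le_trans.
have q0 Z : Z1 <= Z -> 0 < rec_q Z by move=> /V2lt; rewrite sqrtr_gt0 subr_gt0.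
have q1 Z : Z1 <= Z -> rec_q Z <= 1.
  by move=> _; rewrite /rec_q -[leRHS]sqrtr1 ler_wsqrtr// gerBl dotvv_ge0.
have [||Za [Z1a pa pgt0]] := @last_zero _ rec_p Z1 (Num.max Z1 E) p1.
- by move=> Z Z1Z; apply: continuous_rec_p; exact: Zgt0.
- move=> Z; rewrite gt_max => /andP[/ltW Z1Z EZ].
  by apply: lt_le_trans (rec_p_ge (Zgt0 _ Z1Z) (V2lt _ Z1Z)); rewrite subr_gt0.
have Za0 := Zgt0 _ Z1a; have qa0 := q0 _ Z1a.
have DZa : D < Za * rec_q Za.
  by have := rec_p_lt Za0 (V2lt _ Z1a); rewrite pa pmulr_rgt0// subr_gt0.
have [Zb [Zab hZb]] : exists Zb, Za < Zb /\
    D * h (rec_p Zb) (D * rec_q Zb) < Zb * rec_q Zb.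
  have c1 : 1 < Za * rec_q Za / D by rewrite ltr_pdivlMr// mul1r.
  (* The limit of [h] is taken at a fixed density, here D q(Za). Beyond Za the density is larger
     because q grows with Z, and [h] decreases in the density. *)
  have hl := hlim _ (mulr_gt0 D0 qa0).
  have : \forall p \near 0^'+, h p (D * rec_q Za) < Za * rec_q Za / D.
    exact: (cvgr_lt _ hl).
  rewrite near_withinE => /nbhs_ballP[e /= e0 He].
  have [d /= d0 Hd] : nbhs_ball Za [set z | rec_p z < e].
    by apply/nbhs_ballP; apply: (cvgr_lt _ (continuous_rec_p Za0)); rewrite pa.
  have Zad : Za < Za + d / 2 by rewrite ltrDl divr_gt0.
  exists (Za + d / 2); split => //.
  set Zb := Za + d / 2 in Zad *.
  have pb0 := pgt0 _ Zad.
  have Z1b : Z1 <= Zb by exact: le_trans (ltW Zad).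
  have pbe : rec_p Zb < e.
    apply: Hd; rewrite /ball/= /Zb opprD addNKr normrN gtr0_norm ?divr_gt0//.
    by rewrite ltr_pdivrMr// ltr_pMr// ltr1n.
  have qab : rec_q Za <= rec_q Zb.
    by rewrite ler_wsqrtr// lerD2l lerN2 rec_V2_nincr// ltW.
  have hab : h (rec_p Zb) (D * rec_q Zb) <= h (rec_p Zb) (D * rec_q Za).
    by apply: (eos_nincr heos) => //; [exact: mulr_gt0|rewrite ler_wpM2l// ltW].
  have := He (rec_p Zb); rewrite /ball/= sub0r normrN gtr0_norm// => /(_ pbe pb0).
  rewrite ltr_pdivlMr// mulrC => hDa.
  apply: le_lt_trans (ler_wpM2l (ltW D0) hab) _; apply: lt_le_trans hDa _.
  by apply: ler_pM => //; exact: ltW.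
have Z1b : Z1 <= Zb by rewrite (le_trans Z1a)// ltW.
(* Large enough that Zc - E >= Zc / 2, hence 2 p(Zc) >= Zc. *)
pose Zc := Zb + 2 * `|E|.
have bc : Zb <= Zc by rewrite lerDl mulr_ge0.
pose f Z := D * h (rec_p Z) (D * rec_q Z) - Z * rec_q Z.
have [||Z /andP[bZ Zc'] fZ] := @IVT_pointwise _ f Zb Zc 0 bc.
- move=> Z /andP[bZ _]; have Z1Z := le_trans Z1b bZ; have Z0 := Zgt0 _ Z1Z.
  apply: cvgB; last by apply: cvgM; [exact: cvg_id|exact: continuous_rec_q].
  apply: cvgM; first exact: cvg_cst.
  apply: continuous2_cvg; last 2 first.
  - exact: continuous_rec_p.
  - by apply: cvgM; [exact: cvg_cst|exact: continuous_rec_q].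
  apply: (eos_continuous heos); first exact: pgt0 (lt_le_trans Zab bZ).
  by rewrite mulr_gt0// q0.
- rewrite /f subr_le0 ltW//= subr_ge0.
  have Z1c := le_trans Z1b bc; have qc0 := q0 _ Z1c; have qc1 := q1 _ Z1c.
  have pc0 : 0 < rec_p Zc by exact: pgt0 (lt_le_trans Zab bc).
  have rc0 : 0 < D * rec_q Zc by rewrite mulr_gt0.
  have Zc0 := Zgt0 _ Z1c.
  (* The square root in the enthalpy bound is at least p / rho, so h >= 2 p / rho. *)
  have hc : 2 * rec_p Zc / (D * rec_q Zc) <= h (rec_p Zc) (D * rec_q Zc).
    apply: le_trans (hE _ _ pc0 rc0).
    rewrite mulr2n mulrDl mulrDl mul1r lerD2r.
    rewrite -[leLHS]gtr0_norm ?divr_gt0// -sqrtr_sqr ler_wsqrtr//.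
    by rewrite expr_div_n lerDr.
  have ZE : Zc <= 2 * rec_p Zc.
    have := rec_p_ge Zc0 (V2lt _ Z1c); have := ler_norm E; have := Zgt0 _ Z1b.
    by rewrite /Zc; lra.
  apply: (@le_trans _ _ Zc); first by rewrite ger_pMr.
  apply: le_trans ZE _; apply: le_trans (ler_wpM2l (ltW D0) hc).
  rewrite [leRHS](_ : _ = 2 * rec_p Zc / rec_q Zc); last by field; rewrite !gt_eqF.
  by rewrite ler_pdivlMr// ger_pMr// mulr_gt0.
have Z1Z := le_trans Z1b bZ; have Z0 := Zgt0 _ Z1Z; have qZ := q0 _ Z1Z.
have hZ : D * h (rec_p Z) (D * rec_q Z) = Z * rec_q Z.
  by apply/eqP; rewrite -subr_eq0; apply/eqP.
pose w : @prim R := (D * rec_q Z, rec_p Z, rec_v Z, B).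
have wp : physical w.
  split; [exact: mulr_gt0|exact: pgt0 (lt_le_trans Zab bZ)|].
  by rewrite /enorm -[ltRHS]sqrtr1 ltr_sqrt//; exact: V2lt.
have lw : lorentz w = (rec_q Z)^-1 by [].
exists w => //; rewrite /cons lw /= -[prho w]/(D * rec_q Z) -[pp w]/(rec_p Z).
rewrite -[pv w]/(rec_v Z).
have -> : D * rec_q Z * h (rec_p Z) (D * rec_q Z) * (rec_q Z)^-1 ^+ 2 = Z.
  rewrite [X in X * _]mulrAC hZ; field; by rewrite gt_eqF.
rewrite -scalerDl -rec_mE// mulfK ?gt_eqF//; congr mkstate.
rewrite /ptot /pmag lorentzN2// -[pv w]/(rec_v Z) -[pB w]/B -[pp w]/(rec_p Z).
by rewrite /rec_p -/(mag_press (rec_v Z) B); ring.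
Qed.

End recovery.

(** * One step of the scheme *)

Section admissible_characterization.
Context {R : realType}.
Variable h : R -> R -> R.
Hypothesis heos : is_eos h.

Lemma admissibleP (U : state R) : admissible h U <->
  0 < sD U /\ forall u C, dot u u < 1 -> 0 < normal_form u C U + mag_press u C.
Proof.
have [_ hE _ _] := heos; split=> [[w wp <-]|[D0 pos]].
  by split=> [|u C]; [exact: sD_cons_gt0|exact: normal_form_cons_gt0].
have [|w wp wU] := @recover_prim _ _ (sE U) (sm U) (sB U) D0 _ h heos.
  move=> u /(pos u (sB U)); congr (0 < _).
  by rewrite /normal_form /mag_mul /mag_press !dotE (dotC (sB U) u); field.
by exists w; rewrite // wU mkstateK.
Qed.

Lemma dirFZ d (xi : 'rV[R]_d) a (U : state R) : dirF h (a *: xi) U = a *: dirF h xi U.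
Proof. by rewrite /dirF scaler_sumr; apply: eq_bigr => l _; rewrite mxE scalerA. Qed.

Lemma dirBZ d (xi : 'rV[R]_d) a B : dirB (a *: xi) B = a * dirB xi B :> R.
Proof. by rewrite /dirB mulr_sumr; apply: eq_bigr => l _; rewrite mxE mulrA. Qed.

Lemma dirB_linear d (xi : 'rV[R]_d) a B C :
  dirB xi (a *: (B + C)) = a * (dirB xi B + dirB xi C).
Proof. by rewrite -!emb3E dotZr dotDr. Qed.

Lemma dirB_suml d I (r : seq I) (a : I -> R) (xi : I -> 'rV[R]_d) B :
  dirB (\sum_(i <- r) a i *: xi i) B = \sum_(i <- r) a i * dirB (xi i) B.
Proof.
rewrite /dirB; under [RHS]eq_bigr do rewrite mulr_sumr.
rewrite exchange_big /=; apply: eq_bigr => l _; rewrite summxE mulr_suml.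
by apply: eq_bigr => i _; rewrite mxE mulrA.
Qed.

(* The extra terms are what summation over a closed surface and the discrete
   divergence-free condition cancel. *)
Lemma admissible_flux d (xi : 'rV[R]_d) (U : state R) : (d <= 3)%N -> admissible h U ->
  dot xi xi <= 1 ->
  0 <= sD (U + dirF h xi U) /\
  forall u C, dot u u < 1 ->
    dirB xi (sB U) * dot u C - mag_press u C * dirB xi u <=
    normal_form u C (U + dirF h xi U) + mag_press u C.
Proof.
have [_ hE _ _] := heos => d3 /(dirF_prim xi)[w [wp wU ->]] xi1.
rewrite -wU; split=> [|u C u1]; first by apply: sD_flux_ge0 => //; rewrite emb3_unit.
have := normal_form_flux_ge0 hE C wp _ u1; rewrite sB_mk -!emb3E.
by move=> /(_ (emb3 xi)); rewrite emb3_unit// => /(_ xi1); lra.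
Qed.

End admissible_characterization.

(** * Convex decomposition of the new cell average *)

Section scheme_step.
Context {R : realType} {d : nat} (h : R -> R -> R) (M : mesh R d) (K Q : nat).
Variables (w : 'I_Q -> R) (x : M -> M -> 'I_Q -> 'rV[R]_d).
Variable U : M -> 'rV[R]_d -> state R.
Hypotheses (d3 : (d <= 3)%N) (heos : is_eos h) (hquad : quadrature K w x).
Hypothesis hadm : forall k j mu, j \in nbr k -> admissible h (U k (x k j mu)).

Lemma area_ge0 (k j : M) : 0 <= area k j.
Proof. by rewrite fine_ge0// hausdorff_ge0. Qed.

Lemma nbr_sym (k j : M) : j \in nbr k -> k \in nbr j.
Proof. by move=> /nbrP[jk a0]; apply/nbrP; rewrite eq_sym jk /face setIC. Qed.

Lemma normal_dot (k j : M) : j \in nbr k -> dot (normal k j) (normal k j) = 1.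
Proof.
by move=> /normal_unit n1; rewrite -[LHS]sqr_sqrtr ?dotvv_ge0// -/(enorm _) n1 expr1n.
Qed.

(** Values in an arbitrary module allow linear functionals to be moved inside, from means of states
    to means of scalars. *)
Definition face_mean (V : lmodType R) (k : M) (f : M -> 'I_Q -> V) : V :=
  (perimeter k)^-1 *: \sum_(j <- nbr k) area k j *: \sum_(mu < Q) w mu *: f j mu.

Lemma face_meanD (V : lmodType R) k (f g : M -> 'I_Q -> V) :
  face_mean k (fun j mu => f j mu + g j mu) = face_mean k f + face_mean k g.
Proof.
rewrite /face_mean -scalerDr -big_split /=; congr (_ *: _); apply: eq_bigr => j _.
rewrite -scalerDr -big_split /=; congr (_ *: _); apply: eq_bigr => mu _.
by rewrite scalerDr.
Qed.

Lemma face_meanZ (V : lmodType R) k a (f : M -> 'I_Q -> V) :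
  face_mean k (fun j mu => a *: f j mu) = a *: face_mean k f.
Proof.
have comm b c (v : V) : b *: (c *: v) = c *: (b *: v) by rewrite !scalerA mulrC.
rewrite /face_mean comm; congr (_ *: _); rewrite scaler_sumr; apply: eq_bigr => j _.
rewrite comm; congr (_ *: _); rewrite scaler_sumr; apply: eq_bigr => mu _.
exact: comm.
Qed.

Lemma face_mean_linear (V : lmodType R) k (L : {linear state R -> V}) f :
  L (face_mean k f) = face_mean k (fun j mu => L (f j mu)).
Proof.
rewrite /face_mean linearZ linear_sum; congr (_ *: _); apply: eq_bigr => j _ /=.
by rewrite linearZ linear_sum; congr (_ *: _); apply: eq_bigr => mu _; rewrite linearZ.
Qed.

Lemma face_mean_ge0 k (f : M -> 'I_Q -> R^o) :
  (forall j mu, j \in nbr k -> 0 <= f j mu) -> 0 <= face_mean k f.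
Proof.
move=> f0; apply: mulr_ge0.
  by rewrite invr_ge0 sumr_ge0// => j _; exact: area_ge0.
rewrite big_seq sumr_ge0// => j jk; apply: mulr_ge0; first exact: area_ge0.
by rewrite sumr_ge0// => mu _; rewrite mulr_ge0 ?f0// ltW// (weight_gt0 hquad).
Qed.

Lemma face_mean_cst k (c : R^o) : 0 < perimeter k -> face_mean k (fun _ _ => c) = c.
Proof.
move=> P0; rewrite /face_mean; under eq_bigr do
  rewrite -scaler_suml (weight_sum1 hquad) scale1r.
by rewrite -scaler_suml scalerA mulVf ?scale1r// gt_eqF.
Qed.

Variables (alpha dt : R) (Ubar : M -> state R) (beta : M -> R).
Hypotheses (halpha : 1 <= alpha) (hdt : 0 < dt).
Hypothesis hdiv : forall k, divB w x U k = 0.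
Hypothesis hW : forall k, admissible h (inner_state w x U Ubar beta k).

Let ui (k j : M) mu := U k (x k j mu).
Let uo (k j : M) mu := U j (x k j mu).
Let xi (k j : M) := - alpha^-1 *: normal k j.

(** The weights 1 - 2 beta, 2 (beta - s), s and s add up to 1, and the CFL condition s < beta makes
    the second one positive. The direction [xi] carries the minus sign with which the scheme
    subtracts fluxes. *)
Lemma next_average_convex k (s := alpha * dt / (2 * vol k) * perimeter k) :
  0 < perimeter k -> 2 * beta k < 1 ->
  next_average h w x U alpha dt Ubar k =
  (1 - 2 * beta k) *: inner_state w x U Ubar beta k +
  face_mean k (fun j mu => (2 * (beta k - s)) *: ui k j mu +
    s *: ((ui k j mu + dirF h (xi k j) (ui k j mu)) +
          (uo k j mu + dirF h (xi k j) (uo k j mu)))).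
Proof.
move=> P0 b1; rewrite /inner_state scalerA divff ?scale1r; last by rewrite subr_eq0 gt_eqF.
rewrite /next_average -addrA; congr (_ + _).
have -> : (dt / vol k) *: \sum_(j <- nbr k) area k j *: num_flux h w x U alpha k j =
    face_mean k (fun j mu => (2 * s / alpha) *:
      lf_flux h alpha (ui k j mu) (uo k j mu) (normal k j)).
  rewrite face_meanZ /face_mean scalerA; congr (_ *: _).
  rewrite /s invfM; move: (vol k)^-1 => v; field.
  by rewrite !gt_eqF// (lt_le_trans ltr01).
have -> : (2 * beta k / perimeter k) *:
    (\sum_(j <- nbr k) area k j *: \sum_(mu < Q) w mu *: U k (x k j mu)) =
    face_mean k (fun j mu => (2 * beta k) *: ui k j mu).
  by rewrite face_meanZ /face_mean scalerA.
set X := face_mean k _; set Y := face_mean k _; set Z := face_mean k _.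
suff -> : Y = X + Z by rewrite opprD subrK.
rewrite {}/X {}/Y {}/Z -face_meanD; congr face_mean; apply/funext => j; apply/funext => mu.
rewrite /lf_flux /xi !dirFZ; move: s (ui k j mu) (uo k j mu) => s u v.
move: (dirF h _ u) (dirF h _ v) => Fu Fv; apply/rowP => i; rewrite !mxE; field.
by rewrite gt_eqF// (lt_le_trans ltr01).
Qed.

Theorem next_average_admissible k : 0 < beta k < 2^-1 ->
  \sum_(j <- nbr k) area k j *: normal k j = 0 ->
  0 < alpha * dt / (2 * vol k) * perimeter k < beta k ->
  admissible h (next_average h w x U alpha dt Ubar k).
Proof.
move=> /andP[b0 b2] closed /andP[s0 sb].
have P0 : 0 < perimeter k.
  rewrite lt_neqAle eq_sym; apply/andP; split; last first.
    by rewrite sumr_ge0// => j _; exact: area_ge0.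
  by apply/eqP => P0; move: s0; rewrite P0 mulr0 ltxx.
have b2' : 2 * beta k < 1 by lra.
rewrite next_average_convex//; set s := alpha * dt / _ * _ in s0 sb *; clearbody s.
have a0 : 0 < alpha by exact: lt_le_trans halpha.
have xi1 j : j \in nbr k -> dot (xi k j) (xi k j) <= 1.
  move=> jk; rewrite !dotE normal_dot// mulr1 mulrNN -invfM.
  by rewrite invf_le1 ?mulr_gt0// mulr_ege1.
have ui_adm j mu : j \in nbr k -> admissible h (ui k j mu) by move=> jk; exact: hadm.
have uo_adm j mu : j \in nbr k -> admissible h (uo k j mu).
  by move=> jk; rewrite /uo -(node_sym hquad)//; apply: hadm; exact: nbr_sym.
apply/(admissibleP heos); have /(admissibleP heos)[WD Wpos] := hW k; split.
  rewrite linearD linearZ /= ltr_pwDl//; first by rewrite mulr_gt0// subr_gt0.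
  rewrite (face_mean_linear k (@sD R)).
  apply: face_mean_ge0 => j mu jk; rewrite linearD !linearZ linearD /=.
  have [uD _] := admissible_flux heos d3 (ui_adm j mu jk) (xi1 j jk).
  have [vD _] := admissible_flux heos d3 (uo_adm j mu jk) (xi1 j jk).
  have /(admissibleP heos)[/ltW u0 _] := ui_adm j mu jk.
  apply: addr_ge0; apply: mulr_ge0 => //; rewrite ?addr_ge0 ?(ltW s0)//.
  by rewrite mulr_ge0// subr_ge0 ltW.
move=> u C u1.
set N := normal_form u C; set mp := mag_press u C.
rewrite /N linearD linearZ /= (face_mean_linear k (normal_form u C)) -/N.
(* The constant term is shared out with the weights of the convex combination. *)
have -> : mp = (1 - 2 * beta k) * mp + face_mean k (fun _ _ => 2 * beta k * mp : R^o).
  by rewrite face_mean_cst//; ring.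
rewrite addrACA -mulrDr ltr_pwDl//; first by rewrite mulr_gt0 ?subr_gt0 ?Wpos.
rewrite -face_meanD.
pose G j mu : R^o := s * (dirB (xi k j) (sB (ui k j mu) + sB (uo k j mu)) * dot u C)
  - 2 * s * mp * dirB (xi k j) u.
have G0 : face_mean k G = 0.
  have B0 : face_mean k (fun j mu =>
      dirB (xi k j) (sB (ui k j mu) + sB (uo k j mu)) : R^o) = 0.
    (* The factor 2 undoes the mean of the two traces of B in [divB]; - 1 / alpha comes from
       [xi]. *)
    rewrite /face_mean [X in _ *: X](_ : _ = (- 2 / alpha * divB w x U k : R)).
      by rewrite hdiv mulr0 scaler0.
    rewrite /divB mulr_sumr; apply: eq_bigr => j _.
    rewrite /xi /GRing.scale /= [RHS]mulrA [RHS]mulrC; congr (_ * _).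
    rewrite mulr_sumr; apply: eq_bigr => mu _; rewrite dirBZ dirB_linear.
    by rewrite -[sB _ + _]scale1r dirB_linear; field; rewrite gt_eqF.
  have u0 : face_mean k (fun j mu => dirB (xi k j) u : R^o) = 0.
    rewrite /face_mean [X in _ *: X](_ : _ = (- alpha^-1 *
        dirB (\sum_(j <- nbr k) area k j *: normal k j) u : R)).
      by rewrite closed -emb3E /emb3 big1 ?dot0l ?mulr0 ?scaler0// => l _; rewrite mxE scale0r.
    rewrite dirB_suml mulr_sumr; apply: eq_bigr => j _.
    by rewrite -scaler_suml (weight_sum1 hquad) scale1r /xi dirBZ mulrCA.
  have -> : G = (fun j mu => (s * dot u C) *:
        (dirB (xi k j) (sB (ui k j mu) + sB (uo k j mu)) : R^o) +
      (- (2 * s * mp)) *: (dirB (xi k j) u : R^o)).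
    by apply/funext => j; apply/funext => mu; rewrite /G /GRing.scale /=; ring.
  by rewrite face_meanD !face_meanZ B0 u0 !scaler0 addr0.
have GN0 : face_mean k (fun j mu => - G j mu) = 0.
  by under eq_fun2 do rewrite -scaleN1r; rewrite face_meanZ G0 scaler0.
(* After adding the vanishing mean of - G, the inequality holds at every node separately. *)
rewrite -[X in 0 <= X]addr0 -[X in _ + X]GN0 -face_meanD.
apply: face_mean_ge0 => j mu jk.
rewrite linearD !linearZ linearD /=.
have [_ /(_ u C u1) uB] := admissible_flux heos d3 (ui_adm j mu jk) (xi1 j jk).
have [_ /(_ u C u1) vB] := admissible_flux heos d3 (uo_adm j mu jk) (xi1 j jk).
have /(admissibleP heos)[_ /(_ u C u1) uN] := ui_adm j mu jk.
move: uB vB uN; rewrite -/N -/mp.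
rewrite /G -[sB _ + _]scale1r dirB_linear mul1r.
move: (N _) (N _) (N _) (dirB _ (sB _)) (dirB _ (sB _)) (dirB _ u) => n1 n2 n3 B1 B2 du.
rewrite -subr_ge0 => uB; rewrite -subr_ge0 => vB uN.
have bs : 0 <= 2 * (beta k - s) by rewrite mulr_ge0// subr_ge0 ltW.
have := mulr_ge0 (ltW s0) uB; have := mulr_ge0 (ltW s0) vB.
have := mulr_ge0 bs (ltW uN); rewrite /GRing.scale /=; lra.
Qed.

End scheme_step.

(** * Hausdorff measure *)

Section hausdorff_comparison.
Context {R : realType}.
Local Open Scope ereal_scope.

Lemma le_diam n (A B : set 'rV[R]_n) : A `<=` B -> diam A <= diam B.
Proof.
move=> AB; apply: ge_ereal_sup => _ [->|[x Ax [y Ay <-]]]; first exact: diam_ge0.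
by apply: ereal_sup_ubound; right; exists x; [exact: AB|exists y => //; exact: AB].
Qed.

Lemma le_expe (x y : \bar R) s : 0 <= x -> x <= y -> x ^+ s <= y ^+ s.
Proof.
move=> x0 xy; elim: s => // s ih; rewrite !expeS; apply: lee_pmul => //.
exact: expe_ge0.
Qed.

Lemma le_hausdorff_weight n s (A B : set 'rV[R]_n) :
  A `<=` B -> hausdorff_weight s A <= hausdorff_weight s B.
Proof.
move=> AB; rewrite /hausdorff_weight; case: eqP => A0; last first.
  case: eqP => [B0|_]; first by exfalso; apply: A0; move: AB; rewrite B0 subset0.
  apply: lee_pmul => //.
  - by rewrite lee_fin divr_ge0 ?exprn_ge0// unit_ball_volume_ge0.
  - by rewrite expe_ge0// diam_ge0.
  - by rewrite le_expe ?diam_ge0// le_diam.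
by rewrite -/(hausdorff_weight s B) hausdorff_weight_ge0.
Qed.

Lemma le_hausdorff_pre_scale n s (e e' : R) (A : set 'rV[R]_n) : (e <= e')%R ->
  hausdorff_pre s e' A <= hausdorff_pre s e A.
Proof.
move=> ee; apply: ereal_inf_le_tmp => _ [F [dF AF] <-]; exists F => //; split=> // k.
by apply: le_trans (dF k) _; rewrite lee_fin.
Qed.

Section lipschitz.
Context {T : Type} {m n : nat}.
Variables (f : T -> 'rV[R]_m) (g : T -> 'rV[R]_n) (r : R).
Hypothesis r0 : (0 < r)%R.

(** Two maps on a common parameter set are compared, instead of composing with an inverse. This
    covers Lipschitz maps (g = id), inverses of expanding maps (f = id) and isometries. *)
Let lip (A : set T) := forall x y, A x -> A y ->
  (enorm (f x - f y) <= r * enorm (g x - g y))%R.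

Lemma diam_lipschitz A : lip A -> diam (f @` A) <= r%:E * diam (g @` A).
Proof.
move=> fg; apply: ge_ereal_sup => _ [->|[_ [x Ax <-] [_ [y Ay <-] <-]]].
  by rewrite mule_ge0 ?diam_ge0// lee_fin ltW.
apply: (@le_trans _ _ (r%:E * (enorm (g x - g y))%:E)); first by rewrite -EFinM lee_fin fg.
apply: lee_pmul => //; [by rewrite lee_fin ltW|by rewrite lee_fin sqrtr_ge0|].
by apply: ereal_sup_ubound; right; exists (g x); [exists x|exists (g y) => //; exists y].
Qed.

Lemma hausdorff_weight_lipschitz s A : lip A ->
  hausdorff_weight s (f @` A) <= (r ^+ s)%:E * hausdorff_weight s (g @` A).
Proof.
move=> fg; rewrite /hausdorff_weight; case: eqP => A0.
  by rewrite mule_ge0 ?(hausdorff_weight_ge0 s (g @` A))// lee_fin exprn_ge0// ltW.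
case: eqP => [/image_set0_set0 A0'|_]; first by exfalso; apply: A0; rewrite A0' image_set0.
rewrite muleCA; apply: lee_pmul => //.
- by rewrite lee_fin divr_ge0 ?exprn_ge0// unit_ball_volume_ge0.
- by rewrite expe_ge0// diam_ge0.
have -> : (r ^+ s)%:E * diam (g @` A) ^+ s = (r%:E * diam (g @` A)) ^+ s.
  elim: s => [|s ih]; first by rewrite !expe0 mule1.
  by rewrite exprS EFinM !expeS -ih muleACA.
by rewrite le_expe ?diam_ge0// diam_lipschitz.
Qed.

(** Each covering set of g(A) is pulled back to A and pushed forward by f, which multiplies
    diameters by at most r. *)
Lemma hausdorff_pre_lipschitz s e A : lip A ->
  hausdorff_pre s (r * e) (f @` A) <= (r ^+ s)%:E * hausdorff_pre s e (g @` A).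
Proof.
move=> fg; have rs : (0 < r ^+ s)%R by rewrite exprn_gt0.
rewrite -lee_pdivrMl//; apply: le_ereal_inf_tmp => _ [F [dF AF] <-].
rewrite lee_pdivrMl//.
pose G k := A `&` g @^-1` F k.
have fgG k : lip (G k) by move=> x y [Ax _] [Ay _]; exact: fg.
have gG k : g @` G k `<=` F k by move=> _ [x [_ Fx] <-].
apply: (@le_trans _ _ (\sum_(k <oo) hausdorff_weight s (f @` G k))).
  apply: ereal_inf_lbound; exists (fun k => f @` G k) => //; split=> [k|].
    apply: le_trans (diam_lipschitz (fgG k)) _; rewrite EFinM; apply: lee_pmul => //.
    - by rewrite lee_fin ltW.
    - exact: diam_ge0.
    - exact: le_trans (le_diam (gG k)) (dF k).
  move=> _ [x Ax <-]; have [k _ Fk] := AF (g x) (imageP g Ax).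
  by exists k => //; exists x.
rewrite -nneseriesZl; last by move=> *; exact: hausdorff_weight_ge0.
apply: lee_nneseries => [k _ _|k _]; first exact: hausdorff_weight_ge0.
apply: le_trans (hausdorff_weight_lipschitz s (fgG k)) _.
apply: lee_pmul => //; [by rewrite lee_fin ltW|exact: hausdorff_weight_ge0|].
exact: le_hausdorff_weight.
Qed.

Lemma hausdorff_lipschitz s A : lip A ->
  hausdorff s (f @` A) <= (r ^+ s)%:E * hausdorff s (g @` A).
Proof.
move=> fg; apply: ge_ereal_sup => _ [e /= e0 <-].
have -> : e = (r * (e / r))%R by rewrite mulrC divfK// gt_eqF.
apply: le_trans (hausdorff_pre_lipschitz s (e / r) fg) _.
apply: lee_pmul => //; [by rewrite lee_fin exprn_ge0// ltW|exact: hausdorff_pre_ge0|].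
by apply: ereal_sup_ubound; exists (e / r)%R => //=; rewrite divr_gt0.
Qed.

End lipschitz.

Lemma hausdorff_isometry T m n (f : T -> 'rV[R]_m) (g : T -> 'rV[R]_n) s (A : set T) :
  (forall x y, A x -> A y -> enorm (f x - f y) = enorm (g x - g y)) ->
  hausdorff s (f @` A) = hausdorff s (g @` A).
Proof.
move=> fg; apply/eqP; rewrite eq_le; apply/andP; split.
  by have := @hausdorff_lipschitz _ _ _ f g 1 ltr01 s A; rewrite expr1n mul1e;
    apply => x y Ax Ay; rewrite mul1r fg.
by have := @hausdorff_lipschitz _ _ _ g f 1 ltr01 s A; rewrite expr1n mul1e;
  apply => x y Ax Ay; rewrite mul1r fg.
Qed.

(** A covering set of diameter at most e < d meets at most one of A and B. *)
Lemma hausdorff_pre_sepU n s (e d : R) (A B : set 'rV[R]_n) : (e < d)%R ->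
  (forall x y, A x -> B y -> (d <= enorm (x - y))%R) ->
  hausdorff_pre s e A + hausdorff_pre s e B <= hausdorff_pre s e (A `|` B).
Proof.
move=> ed sep; apply: le_ereal_inf_tmp => _ [F [dF ABF] <-].
have le1 (C : set 'rV[R]_n) : C `<=` A `|` B ->
    hausdorff_pre s e C <= \sum_(k <oo) hausdorff_weight s (F k `&` C).
  move=> CAB; apply: ereal_inf_lbound; exists (fun k => F k `&` C) => //; split=> [k|x Cx].
    by apply: le_trans (dF k); apply: le_diam; exact: subIsetl.
  by have [k _ Fk] := ABF x (CAB x Cx); exists k.
apply: le_trans (leeD (le1 A _) (le1 B _)) _ => //.
rewrite -nneseriesD => [|k _ _|k _ _]; try exact: hausdorff_weight_ge0.
apply: lee_nneseries => [k _ _|k _]; first by rewrite adde_ge0// hausdorff_weight_ge0.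
have [FA|/eqP/set0P[x [Fx Ax]]] := pselect (F k `&` A = set0).
  rewrite FA [hausdorff_weight s set0]/hausdorff_weight eqxx add0e.
  by apply: le_hausdorff_weight; exact: subIsetl.
have FB : F k `&` B = set0.
  apply/seteqP; split => // y [Fy By].
  have : (enorm (x - y))%:E <= e%:E.
    by apply: le_trans (dF k); apply: ereal_sup_ubound; right; exists x => //; exists y.
  by rewrite lee_fin => /(le_trans (sep x y Ax By)); rewrite leNgt ed.
rewrite FB [hausdorff_weight s set0]/hausdorff_weight eqxx adde0.
by apply: le_hausdorff_weight; exact: subIsetl.
Qed.

Lemma hausdorff_sepU n s (d : R) (A B : set 'rV[R]_n) : (0 < d)%R ->
  (forall x y, A x -> B y -> (d <= enorm (x - y))%R) ->
  hausdorff s A + hausdorff s B <= hausdorff s (A `|` B).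
Proof.
move=> d0 sep; have [->|ABfin] := eqVneq (hausdorff s (A `|` B)) +oo.
  exact: leey.
have Ble : hausdorff s B <= hausdorff s (A `|` B) by apply: le_hausdorff; exact: subsetUr.
have Ale : hausdorff s A <= hausdorff s (A `|` B) by apply: le_hausdorff; exact: subsetUl.
have fin C : hausdorff s C <= hausdorff s (A `|` B) -> hausdorff s C \is a fin_num.
  move=> Cle; rewrite ge0_fin_numE ?hausdorff_ge0//; apply: le_lt_trans Cle _.
  by rewrite ltey.
rewrite -leeBrDr ?fin//; apply: ge_ereal_sup => _ [e /= e0 <-].
have preAfin : hausdorff_pre s e A \is a fin_num.
  rewrite ge0_fin_numE ?hausdorff_pre_ge0//.
  apply: (@le_lt_trans _ _ (hausdorff s A)); first by apply: ereal_sup_ubound; exists e.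
  by rewrite ltey_eq fin.
rewrite leeBrDr ?fin// addeC -leeBrDr//; apply: ge_ereal_sup => _ [e' /= e'0 <-].
rewrite leeBrDr// addeC.
(* The two suprema come with scales of their own; e2 refines both and lies below the separation
   d. *)
pose e2 := Num.min (Num.min e e') (d / 2)%R.
have e2e : (e2 <= e)%R by rewrite /e2 !ge_min lexx.
have e2e' : (e2 <= e')%R by rewrite /e2 !ge_min lexx orbT.
have e2d : (e2 < d)%R by rewrite /e2 gt_min ltr_pdivrMr// ltr_pMr// ltr1n orbT.
apply: le_trans (leeD (le_hausdorff_pre_scale s A e2e) (le_hausdorff_pre_scale s B e2e')) _.
apply: le_trans (hausdorff_pre_sepU s e2d sep) _.
by apply: ereal_sup_ubound; exists e2 => //=; rewrite /e2 !lt_min e0 e'0 divr_gt0.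
Qed.

End hausdorff_comparison.

Section hausdorff_measurable.
Context {R : realType} {n : nat} (s : nat).
Local Open Scope ereal_scope.
Local Notation H := (@hausdorff R n s).

(* Caratheodory's criterion: the layers [R_ k] where f lies between two
   consecutive thresholds t_ k -> c have summable measures, because layers two
   steps apart are at positive distance. *)
Lemma caratheodory_lipschitz_lt (f : 'rV[R]_n -> R) (c : R) :
  (forall x y, (`|f x - f y| <= enorm (x - y))%R) ->
  H.-caratheodory [set x | (f x < c)%R].
Proof.
move=> flip; apply: le_caratheodory_measurable => X.
rewrite -![_ (X `&` _)]/(H _) -[leRHS]/(H X).
have [->|Xoo] := eqVneq (H X) +oo; first exact: leey.
have Xfin : H X \is a fin_num.
  by rewrite ge0_fin_numE ?hausdorff_ge0// ltey.
pose t (k : nat) : R := (c - k.+1%:R^-1)%R.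
have tS k : (t k < t k.+1)%R.
  by rewrite /t ltrD2l ltrN2 ltf_pV2 ?posrE// ltr_nat.
have tc k : (t k < c)%R by rewrite /t gtrBl invr_gt0.
have sep (a b : R) (A B : set 'rV[R]_n) : (a < b)%R ->
    (forall x, A x -> f x <= a)%R -> (forall x, B x -> b <= f x)%R ->
    H A + H B <= H (A `|` B).
  move=> ab Aa Bb; apply: (@hausdorff_sepU _ _ _ (b - a)); first by rewrite subr_gt0.
  move=> x y /Aa fa /Bb fb; apply: le_trans (flip _ _).
  by rewrite distrC; apply: le_trans (ler_norm _); rewrite lerB.
(* [R_ k] is at positive distance from [A_ k] and both lie in [A_ k.+2], so the bounds telescope in
   steps of two. *)
pose A_ k := X `&` [set x | (f x <= t k)%R].
pose R_ k := X `&` [set x | (t k.+1 < f x <= t k.+2)%R].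
have leX A : X `&` A `<=` X by move=> x [].
have AR k : H (A_ k) + H (R_ k) <= H (A_ k.+2).
  apply: le_trans (sep _ _ _ _ (tS k) _ _) _.
  - by move=> x [].
  - by move=> x [_ /andP[/ltW]].
  apply: le_hausdorff => x [[Xx fx]|[Xx /andP[_ fx]]]; split => //=.
  by apply: le_trans fx _; apply: ltW; exact: lt_trans (tS _) (tS _).
have sumR N : \sum_(k < N) H (R_ k) <= H (A_ N) + H (A_ N.+1).
  elim: N => [|N ih]; first by rewrite big_ord0 adde_ge0 ?hausdorff_ge0.
  rewrite big_ord_recr /=; apply: le_trans (leeD ih (lexx _)) _.
  by rewrite addeAC addeC leeD2l.
have sumRoo : \sum_(k <oo) H (R_ k) < +oo.
  apply: (@le_lt_trans _ _ (H X + H X)); last by rewrite lte_add_pinfty// ltey.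
  apply: lime_le; first by apply: is_cvg_nneseries => k _ _; exact: hausdorff_ge0.
  apply: nearW => N; rewrite big_mkord; apply: le_trans (sumR N) _.
  by apply: leeD; apply: le_hausdorff; exact: leX.
have tail0 := nneseries_tail_cvg sumRoo (fun k _ => hausdorff_ge0 s (R_ k)).
have lim : H X + \sum_(N <= k <oo) H (R_ k) @[N --> \oo] --> H X + 0.
  by apply: cvgeD tail0; [rewrite fin_num_adde_defr|exact: cvg_cst].
rewrite adde0 in lim.
suff bound N : H (X `&` [set x | (f x < c)%R]) + H (X `&` ~` [set x | (f x < c)%R]) <=
    H X + \sum_(N <= k <oo) H (R_ k).
  by apply: (cvge_to_ge lim); exact: nearW.
have cover : X `&` [set x | (f x < c)%R] `<=`
    A_ N.+1 `|` \bigcup_(k in ~` `I_N) R_ k.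
  move=> x [Xx /= fc].
  have [k fk] := ltr_add_invr fc.
  have tP : exists k, (f x <= t k)%R by exists k; rewrite lerBrDr ltW.
  have tmono : {homo t : i j / (i <= j)%N >-> (i <= j)%R}.
    by apply: homo_leq => // [?|i]; [exact: le_trans|exact: ltW].
  case: (ex_minnP tP) => m fm mmin.
  have [mN|Nm] := leqP m N.+1; first by left; split => //=; exact: le_trans (tmono _ _ mN).
  (* By minimality t (m - 1) < f x <= t m, which is the layer of index m - 2; m > N + 1 places it in
     the tail. *)
  right; exists m.-2; first by apply/negP; rewrite -leqNgt; case: m Nm {fm mmin} => [|[|m]].
  case: m Nm fm mmin => [|[|m]]// Nm fm mmin; split => //=; rewrite fm andbT ltNge.
  by apply/negP => /mmin; rewrite ltnn.
apply: (@le_trans _ _ (H (A_ N.+1) + \sum_(N <= k <oo) H (R_ k) +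
    H (X `&` ~` [set x | (f x < c)%R]))).
  apply: leeD => //; apply: le_trans (le_hausdorff s cover) _.
  apply: le_trans (outer_measureU2 H _ _) _; apply: leeD => //.
  exact: (outer_measure_sigma_subadditive_tail H N R_).
rewrite addeAC leeD2r//; apply: le_trans (sep _ _ _ _ (tc N.+1) _ _) _.
- by move=> x [].
- by move=> x [_ /= /negP]; rewrite -leNgt.
by apply: le_hausdorff => x [] [].
Qed.

End hausdorff_measurable.

(** * Finiteness on cubes, invariance and scaling *)

Section hausdorff_cube.
Context {R : realType} {n : nat}.

Definition cube (r : R) : set 'rV[R]_n := [set x | forall i, `|x 0 i| < r].

Lemma enorm_le_coord (x : 'rV[R]_n) a : (forall i, `|x 0 i| <= a) ->
  enorm x <= Num.sqrt n%:R * a.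
Proof.
move=> xa; case: n x xa => [|m] x xa.
  by rewrite /enorm /dot big_ord0 sqrtr0 mul0r.
have a0 : 0 <= a by exact: le_trans (xa 0).
rewrite -[X in _ * X](ger0_norm a0) -sqrtr_sqr -sqrtrM// ler_wsqrtr//.
rewrite mulr_natl -[X in _ *+ X]card_ord -sumr_const; apply: ler_sum => i _.
by rewrite -expr2 -real_normK ?num_real// ler_sqr ?nnegrE.
Qed.

Lemma coord_le_enorm (x : 'rV[R]_n) i : `|x 0 i| <= enorm x.
Proof.
rewrite -sqrtr_sqr ler_wsqrtr// /dot (bigD1 i)//= expr2 lerDl.
by apply: sumr_ge0 => j _; rewrite -expr2 sqr_ge0.
Qed.

Lemma enormZ (a : R) (x : 'rV[R]_n) : enorm (a *: x) = `|a| * enorm x.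
Proof. by rewrite /enorm dotZl dotZr mulrA sqrtrM -?expr2 ?sqr_ge0// sqrtr_sqr. Qed.

Lemma enormN (x : 'rV[R]_n) : enorm (- x) = enorm x.
Proof. by rewrite /enorm dotNl dotNr opprK. Qed.

Local Open Scope ereal_scope.

(** Half-open cubes of side 2 / m, which subdivide the cube of side 2. *)
Let cell m (t : {ffun 'I_n -> 'I_m}) : set 'rV[R]_n :=
  [set x | forall i, (t i)%:R <= (x 0 i + 1) / 2 * m%:R < (t i)%:R + 1]%R.

Let diam_cell m t : (0 < m)%N -> diam (@cell m t) <= (Num.sqrt n%:R * (2 / m%:R))%:E.
Proof.
move=> m0; apply: ge_ereal_sup => _ [->|[x xt [y yt <-]]].
  by rewrite lee_fin mulr_ge0 ?sqrtr_ge0// divr_ge0.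
rewrite lee_fin; apply: enorm_le_coord => i; rewrite !mxE.
have m0' : (0 < m%:R :> R)%R by rewrite ltr0n.
have /andP[x1 x2] := xt i; have /andP[y1 y2] := yt i.
rewrite ler_pdivlMr// -[X in (_ * X)%R](gtr0_norm m0') -normrM ler_norml.
by apply/andP; split; lra.
Qed.

Let cover_cell m : (0 < m)%N -> cube 1 `<=` \bigcup_t @cell m t.
Proof.
move=> m0 x x1; have m0' : (0 < m%:R :> R)%R by rewrite ltr0n.
have x0 i : (0 <= (x 0 i + 1) / 2 * m%:R)%R.
  by have := x1 i; rewrite ltr_norml => /andP[? ?]; rewrite mulr_ge0// divr_ge0//; lra.
have tm i : (Num.truncn ((x 0%R i + 1) / 2 * m%:R)%R < m)%N.
  rewrite truncn_lt_nat; last exact: x0.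
  rewrite -[ltRHS]mul1r ltr_pM2r//.
  by have := x1 i; rewrite ltr_norml => /andP[? ?]; lra.
exists [ffun i => Ordinal (tm i)] => // i; rewrite ffunE /=.
by rewrite natr1; exact: truncn_itv.
Qed.

(** The m^n cells have weights of order m^-n, so their total weight is bounded by a constant C
    independent of m, however fine the subdivision. *)
Lemma hausdorff_cube_lty : hausdorff n (cube 1) < +oo.
Proof.
pose C : R := (unit_ball_volume n / 2 ^+ n * (Num.sqrt n%:R * 2) ^+ n)%R.
have C0 : (0 <= C)%R.
  apply: mulr_ge0; first by rewrite divr_ge0 ?exprn_ge0// unit_ball_volume_ge0.
  by rewrite exprn_ge0// mulr_ge0// sqrtr_ge0.
apply: (@le_lt_trans _ _ C%:E); last exact: ltry.
apply: ge_ereal_sup => _ [e /= e0 <-].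
pose m := (Num.truncn (Num.sqrt n%:R * 2 / e)).+1.
have m0 : (0 < m%:R :> R)%R by rewrite ltr0n.
have me : (Num.sqrt n%:R * (2 / m%:R) <= e)%R.
  rewrite mulrA ler_pdivrMr// [leRHS]mulrC -ler_pdivrMr//.
  by apply: ltW; exact: truncnS_gt.
pose N := #|{: {ffun 'I_n -> 'I_m}}|.
pose F k := if insub k is Some i then cell (enum_val (i : 'I_N)) else set0.
have F0 k : (N <= k)%N -> F k = set0.
  by move=> Nk; rewrite /F insubF// ltnNge Nk.
have Fd k : diam (F k) <= (Num.sqrt n%:R * (2 / m%:R))%:E.
  rewrite /F; case: insubP => [i _ _|_]; first exact: diam_cell.
  by rewrite diam0 lee_fin mulr_ge0 ?sqrtr_ge0// divr_ge0.
apply: (@le_trans _ _ (\sum_(k <oo) hausdorff_weight n (F k))).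
  apply: ereal_inf_lbound; exists F => //; split=> [k|x /(@cover_cell m isT)[t _ xt]].
    by apply: le_trans (Fd k) _; rewrite lee_fin.
  by exists (enum_rank t : nat) => //; rewrite /F valK enum_rankK.
rewrite (nneseries_split 0 N); last by move=> *; exact: hausdorff_weight_ge0.
rewrite [X in _ + X]eseries0 ?adde0; last first.
  by move=> k Nk _; rewrite F0// /hausdorff_weight eqxx.
apply: (@le_trans _ _ (\sum_(0 <= k < 0 + N) (C / m%:R ^+ n)%:E)).
  apply: lee_sum => k _; rewrite /hausdorff_weight; case: eqP => _.
    by rewrite lee_fin divr_ge0 ?exprn_ge0// ltW.
  apply: (@le_trans _ _ ((unit_ball_volume n / 2 ^+ n)%:E *
      ((Num.sqrt n%:R * (2 / m%:R)) ^+ n)%:E)).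
    apply: lee_pmul => //.
    - by rewrite lee_fin divr_ge0 ?exprn_ge0// unit_ball_volume_ge0.
    - by rewrite expe_ge0// diam_ge0.
    - by rewrite EFin_expe le_expe ?diam_ge0.
  by rewrite -EFinM lee_fin /C !mulrA exprMn exprVn !mulrA.
rewrite sumEFin lee_fin sumr_const_nat add0n subn0.
rewrite /N card_ffun !card_ord -[leLHS]mulr_natr natrX divfK//.
by rewrite expf_neq0// gt_eqF.
Qed.

End hausdorff_cube.

Section hausdorff_invariance.
Context {R : realType} {n : nat} (s : nat).
Implicit Types (A B : set 'rV[R]_n) (v : 'rV[R]_n).

Lemma hausdorff_translate A v : hausdorff s [set x | A (x + v)] = hausdorff s A.
Proof.
have -> : [set x | A (x + v)] = (fun x => x - v) @` A.
  apply/seteqP; split=> [x Axv|_ [x Ax <-]]; last by rewrite /= subrK.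
  by exists (x + v) => //; rewrite addrK.
rewrite -[in RHS](image_id A); apply: hausdorff_isometry => x y _ _.
by rewrite opprB addrA subrK.
Qed.

Lemma hausdorff_opp A : hausdorff s [set x | A (- x)] = hausdorff s A.
Proof.
have -> : [set x | A (- x)] = -%R @` A.
  apply/seteqP; split=> [x Ax|_ [x Ax <-]]; last by rewrite /= opprK.
  by exists (- x) => //; rewrite opprK.
rewrite -[in RHS](image_id A); apply: hausdorff_isometry => x y _ _.
by rewrite -opprD enormN.
Qed.

Lemma hausdorff_scale A (c : R) : 0 < c ->
  hausdorff s [set x | A (c *: x)] = ((c ^+ s)^-1%:E * hausdorff s A)%E.
Proof.
move=> c0; have cs0 : 0 < c ^+ s by rewrite exprn_gt0.
have V0 : 0 < c^-1 by rewrite invr_gt0.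
apply/eqP; rewrite eq_le; apply/andP; split.
  have -> : [set x | A (c *: x)] = *:%R c^-1 @` A.
    apply/seteqP; split=> [x Ax|_ [x Ax <-]]; last by rewrite /= scalerA divff ?scale1r// gt_eqF.
    by exists (c *: x) => //; rewrite scalerA mulVf ?scale1r// gt_eqF.
  have := @hausdorff_lipschitz _ _ _ _ ( *:%R c^-1) id c^-1 V0 s A.
  rewrite image_id exprVn; apply=> x y _ _.
  by rewrite -scalerBr enormZ gtr0_norm.
rewrite lee_pdivrMl//.
have {1}-> : A = *:%R c @` [set x | A (c *: x)].
  apply/seteqP; split=> [x Ax|_ [x Ax <-]//].
  exists (c^-1 *: x) => /=; rewrite scalerA divff ?scale1r ?gt_eqF//.
have := @hausdorff_lipschitz _ _ _ _ ( *:%R c) id c c0 s [set x | A (c *: x)].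
rewrite image_id; apply=> x y _ _.
by rewrite -scalerBr enormZ gtr0_norm.
Qed.

Lemma hausdorff_cubeE (r : R) : 0 < r ->
  hausdorff s (cube r : set 'rV[R]_n) = ((r ^+ s)%:E * hausdorff s (cube 1 : set 'rV[R]_n))%E.
Proof.
move=> r0; have -> : cube r = [set x : 'rV[R]_n | cube 1 (r^-1 *: x)].
  by apply/seteqP; split=> x xr i; have := xr i; rewrite mxE normrM gtr0_norm ?invr_gt0//
    mulrC ltr_pdivrMr// mul1r.
by rewrite hausdorff_scale ?invr_gt0// exprVn invrK.
Qed.

End hausdorff_invariance.

(** * The Borel sigma-algebra of R^n and the measure H^n on it *)

Section row_measurable.
Context {R : realType} {n : nat}.

(** These generators are sublevel sets of coordinates. Coordinates are 1-Lipschitz, so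
    [caratheodory_lipschitz_lt] applies to the generators. *)
Definition half_spaces : set (set 'rV[R]_n) :=
  [set A | exists (i : 'I_n) (c : R), A = [set x : 'rV[R]_n | x 0 i < c]].

Definition row_type := g_sigma_algebraType half_spaces.

Lemma measurable_coord (i : 'I_n) : measurable_fun setT (fun x : row_type => x 0 i : R).
Proof.
apply: (measurability _ (RGenInftyO.measurableE R)) => _ [_ [c ->] <-].
by rewrite setTI; apply: sub_sigma_algebra; exists i, c; apply/seteqP; split => x /=;
  rewrite in_itv.
Qed.

Lemma measurable_to_row d (T : measurableType d) (f : T -> row_type) :
  (forall i, measurable_fun setT (fun t => f t 0 i : R)) -> measurable_fun setT f.
Proof.
move=> mf; apply: (@measurability _ _ _ _ setT f half_spaces erefl).
move=> _ [_ [i [c ->]] <-].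
have -> : f @^-1` [set x | x 0 i < c] = (fun t => f t 0 i) @^-1` `]-oo, c[.
  by apply/seteqP; split => x /=; rewrite in_itv.
by apply: mf.
Qed.

Lemma measurable_box (B : 'I_n -> set R) : (forall i, measurable (B i)) ->
  measurable ([set x | forall i, B i (x 0 i)] : set row_type).
Proof.
move=> mB; rewrite -[X in measurable X]setCK; apply: measurableC.
have -> : ~` [set x : row_type | forall i, B i (x 0 i)] =
    \bigcup_i ((fun x : row_type => x 0 i : R) @^-1` ~` B i).
  apply/seteqP; split => x /=; first by move=> /existsNP[i Bi]; exists i.
  by move=> [i _ Bi] /(_ i).
apply: countable_bigcupT_measurable => // i; rewrite -[X in measurable X]setTI.
exact: (measurable_coord i measurableT (measurableC (mB i))).
Qed.

Lemma measurable_cube r : measurable (cube r : set row_type).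
Proof.
have -> : cube r = [set x | forall i, ball 0 r (x 0 i)] :> set row_type.
  by apply/seteqP; split => x xr i /=; have := xr i; rewrite /ball/= sub0r normrN.
by apply: (@measurable_box (fun=> ball 0 r)) => i; exact: measurable_ball.
Qed.

Lemma ball_rowP (x y : 'rV[R]_n) e : 0 < e -> ball x e y <-> forall i, `|x 0 i - y 0 i| < e.
Proof.
by move=> e0; split=> [[_ xy] i|xy]; [exact: (xy 0 i)|split=> // i j; rewrite ord1; exact: xy].
Qed.

Lemma measurable_row_open (A : set 'rV[R]_n) : open A -> measurable (A : set row_type).
Proof.
move=> oA.
pose box (q : 'rV[rat]_n) (k : nat) : set 'rV[R]_n :=
  [set x | forall i, `|x 0 i - ratr (q 0 i)| < k.+1%:R^-1].
have mbox q k : measurable (box q k : set row_type).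
  have -> : box q k = [set x : 'rV[R]_n | forall i, ball (ratr (q 0 i) : R) k.+1%:R^-1 (x 0 i)]
      :> set row_type.
    by apply/seteqP; split => x xr i /=; have := xr i; rewrite /ball/= distrC.
  apply: (@measurable_box (fun i => ball (ratr (q 0 i) : R) k.+1%:R^-1)) => i.
  exact: measurable_ball.
have -> : A = \bigcup_(p in [set p | box p.1 p.2 `<=` A]) box p.1 p.2.
  apply/seteqP; split=> [x Ax|x [p pA /pA//]].
  have [e /= e0 xe] : nbhs_ball x A by apply/nbhs_ballP; exact: open_nbhs_nbhs.
  have [k ke] := ltr_add_invr (divr_gt0 e0 (ltr0n R 2)); rewrite add0r in ke.
  have qP i : exists q : rat, `|x 0 i - ratr q| < k.+1%:R^-1.
    have [|q] := @rat_in_itvoo R (x 0 i - k.+1%:R^-1) (x 0 i + k.+1%:R^-1).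
      by rewrite ltrD2l gt0_cp// invr_gt0.
    by rewrite in_itv/= => q12; exists q; rewrite distrC ltr_distl.
  pose q : 'rV[rat]_n := \row_i xchoose (qP i).
  have xq i : `|x 0 i - ratr (q 0 i)| < k.+1%:R^-1.
    by rewrite mxE; exact: (xchooseP (qP i)).
  exists (q, k) => // y yq; apply: xe; apply/ball_rowP => // i.
  apply: le_lt_trans (ler_distD (ratr (q 0 i)) _ _) _; rewrite [X in _ + X]distrC.
  by rewrite (splitr e) ltrD// (lt_trans _ ke).
rewrite bigcup_mkcond; apply: countable_bigcupT_measurable => // -[q k].
by case: ifP => // _; exact: mbox.
Qed.

Lemma measurable_row_closed (A : set 'rV[R]_n) : closed A -> measurable (A : set row_type).
Proof.
move=> cA; rewrite -[A]setCK; apply: measurableC; apply: measurable_row_open.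
exact: closed_openC.
Qed.

Local Open Scope ereal_scope.

Lemma measurable_caratheodory s (A : set row_type) : measurable A ->
  (hausdorff s : {outer_measure set 'rV[R]_n -> \bar R}).-caratheodory A.
Proof.
move: A; apply: smallest_sub.
  exact: (@sigma_algebra_measurable _ (caratheodory_type (hausdorff s : {outer_measure set 'rV[R]_n -> \bar R}))).
move=> _ [i [c ->]]; apply: caratheodory_lipschitz_lt => x y.
by have := coord_le_enorm (x - y) i; rewrite !mxE.
Qed.

Definition row_hausdorff : set row_type -> \bar R := hausdorff n.

Let row_hausdorff0 : row_hausdorff set0 = 0. Proof. exact: hausdorff0. Qed.

Let row_hausdorff_ge0 A : 0 <= row_hausdorff A. Proof. exact: hausdorff_ge0. Qed.

Let row_hausdorff_sigma_additive : semi_sigma_additive row_hausdorff.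
Proof.
move=> F mF tF mUF.
by apply: (@caratheodory_measure_sigma_additive R _
  (hausdorff n : {outer_measure set 'rV[R]_n -> \bar R})) => // [k|];
  apply: measurable_caratheodory.
Qed.

HB.instance Definition _ := isMeasure.Build _ _ _ row_hausdorff
  row_hausdorff0 row_hausdorff_ge0 row_hausdorff_sigma_additive.

(** Sigma-finiteness makes Tonelli's theorem available for the product of this measure with
    itself. *)
Lemma row_hausdorff_sigma_finite : sigma_finite setT row_hausdorff.
Proof.
exists (fun k => cube k.+1%:R).
  apply/seteqP; split => // x _.
  exists (Num.truncn (enorm x)) => // i.
  by apply: le_lt_trans (coord_le_enorm x i) _; exact: truncnS_gt.
move=> k; split; first exact: measurable_cube.
by rewrite /row_hausdorff hausdorff_cubeE// lte_mul_pinfty ?hausdorff_cube_lty.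
Qed.

HB.instance Definition _ := Measure_isSigmaFinite.Build _ _ _ row_hausdorff
  row_hausdorff_sigma_finite.

End row_measurable.

(* Uniqueness of translation-invariant measures, by Fubini's theorem: the two
   sides compute the same double integral. *)
Section fubini_translation.
Context {R : realType} {n : nat}.
Local Notation V := (@row_type R n).
Variable E : V -> V.
Hypotheses (ED : forall x y : 'rV[R]_n, E (x + y) = E x + E y :> 'rV[R]_n).
Hypotheses (Esurj : forall y, exists x, E x = y) (mE : measurable_fun setT E).
Local Notation H := (@hausdorff R n n).

Let EN (x : 'rV[R]_n) : E (- x) = - (E x : 'rV[R]_n) :> 'rV[R]_n.
Proof.
have E0 : E 0 = 0 :> 'rV[R]_n.
  by have := ED 0 0; rewrite addr0 => /(congr1 (fun z => z - (E 0 : 'rV[R]_n)));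
    rewrite subrr addrK.
by apply/eqP; rewrite -subr_eq0 opprK -ED addNr E0.
Qed.

Local Open Scope ereal_scope.

(** If E w = v, the set is the translate of the preimage of B by w. *)
Let preE_translate (B : set 'rV[R]_n) v : H [set z | B (v + E z)%R] = H (E @^-1` B).
Proof.
have [w <-] := Esurj v; rewrite -(hausdorff_translate n (E @^-1` B) w).
by congr (H _); apply/seteqP; split => z /=; rewrite ED addrC.
Qed.

Let integral_section (A : set V) (c : \bar R) (F : V -> \bar R) : measurable A -> 0 <= c ->
  (forall x, A x -> F x = c) -> (forall x, ~ A x -> F x = 0) ->
  \int[row_hausdorff]_x F x = c * H A.
Proof.
move=> mA c0 FA F0.
transitivity (\int[row_hausdorff]_x (c * (\1_A x)%:E)).
  apply: eq_integral => x _; rewrite indicE; case: (pselect (A x)) => Ax.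
    by rewrite mem_set// mule1 FA.
  by rewrite memNset// mule0 F0.
rewrite ge0_integralZl//; last exact/measurable_EFinP.
by rewrite integral_indic// setIT.
Qed.

Lemma hausdorff_fubini (A B : set V) : measurable A -> measurable B ->
  H A * H (E @^-1` B) = H B * H (E @^-1` A).
Proof.
move=> mA mB.
have mcoord2 (i : 'I_n) : measurable_fun setT (fun p : V * V => E p.2 0%R i : R).
  apply: (measurableT_comp (measurable_coord i)).
  by apply: (measurableT_comp mE); exact: measurable_snd.
have mcoord1 (i : 'I_n) : measurable_fun setT (fun p : V * V => p.1 0%R i : R).
  by apply: (measurableT_comp (measurable_coord i)); exact: measurable_fst.
(* [C2] is [C1] after the shear x -> x + E z, which translates each section at fixed z. At fixed
   first coordinate, the sections of [C1] are translates of the preimage of B, those of [C2]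
   reflected translates of the preimage of A. *)
pose C1 : set (V * V) := [set p | A p.1 /\ B ((p.1 : 'rV[R]_n) + E p.2)%R].
pose C2 : set (V * V) := [set p | A ((p.1 : 'rV[R]_n) - E p.2)%R /\ B p.1].
have mfst (X : set V) : measurable X -> measurable ([set p | X p.1] : set (V * V)).
  by move=> mX; rewrite -[X in measurable X]setTI; apply: measurable_fst.
have mC1 : measurable C1.
  apply: measurableI; first exact: mfst.
  rewrite -[X in measurable X]setTI.
  have : measurable_fun setT (fun p : V * V => ((p.1 : 'rV[R]_n) + E p.2)%R : V).
    apply: measurable_to_row => i; under eq_fun do rewrite mxE.
    exact: measurable_funD.
  by apply.
have mC2 : measurable C2.
  apply: measurableI; last exact: mfst.
  rewrite -[X in measurable X]setTI.
  have : measurable_fun setT (fun p : V * V => ((p.1 : 'rV[R]_n) - E p.2)%R : V).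
    apply: measurable_to_row => i; under eq_fun do rewrite !mxE.
    exact: measurable_funB.
  by apply.
have F (C : set (V * V)) (mC : measurable C) :
    \int[row_hausdorff]_x (row_hausdorff \o xsection C) x =
    \int[row_hausdorff]_z (row_hausdorff \o ysection C) z.
  have := @indic_fubini_tonelli _ _ _ _ R (@row_hausdorff R n) (@row_hausdorff R n) C mC.
  by rewrite (indic_fubini_tonelli_FE row_hausdorff mC) (indic_fubini_tonelli_GE row_hausdorff mC).
transitivity (\int[row_hausdorff]_x (row_hausdorff \o xsection C1) x).
  rewrite muleC; apply/esym; apply: integral_section => // [|x Ax|x Ax].
  - exact: hausdorff_ge0.
  - rewrite /= -(preE_translate B x); congr (H _).
    by apply/seteqP; split=> [z /xsectionP[]//|z Bz]; apply/xsectionP; split.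
  - rewrite -[RHS](@hausdorff0 R n n); congr (H _).
    by apply/seteqP; split=> // z /xsectionP[].
rewrite F//; transitivity (\int[row_hausdorff]_x (row_hausdorff \o ysection C2) x).
  apply: eq_integral => z _ /=.
  rewrite /row_hausdorff -(hausdorff_translate n (ysection C2 z) (E z)); congr (H _).
  apply/seteqP; split=> x /=.
    by move=> /ysectionP[Ax Bx]; apply/ysectionP; split => //=; rewrite addrK.
  by move=> /ysectionP[/= Ax Bx]; apply/ysectionP; split => //=; rewrite addrK in Ax.
rewrite -F// muleC; apply: integral_section => // [|x Bx|x Bx].
- exact: hausdorff_ge0.
- rewrite /= -(preE_translate A x) -(hausdorff_opp n [set z | A (x + E z)%R]); congr (H _).
  apply/seteqP; split=> z /=; first by move=> /xsectionP[Az _]; rewrite EN.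
  by rewrite EN => Az; apply/xsectionP; split.
- rewrite -[RHS](@hausdorff0 R n n); congr (H _).
  by apply/seteqP; split=> // z /xsectionP[].
Qed.

End fubini_translation.

(** * Stretching a single coordinate *)

Section hausdorff_dilation.
Context {R : realType} {n : nat}.
Local Notation V := (@row_type R n).
Local Notation H := (@hausdorff R n n).
Variable c : R.
Hypothesis c0 : 0 < c.

Definition dilate (P : pred 'I_n) (x : 'rV[R]_n) : 'rV[R]_n :=
  \row_i (if P i then c * x 0 i else x 0 i).

Let dilateD P x y : dilate P (x + y) = dilate P x + dilate P y.
Proof. by apply/rowP => i; rewrite !mxE; case: ifP => _; rewrite ?mulrDr. Qed.

Let dilate_surj P y : exists x, dilate P x = y.
Proof.
exists (\row_i (if P i then c^-1 * y 0 i else y 0 i)); apply/rowP => i; rewrite !mxE.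
by case: (P i); rewrite // mulrA divff ?mul1r// gt_eqF.
Qed.

Lemma measurable_dilate P : measurable_fun setT (dilate P : V -> V).
Proof.
apply: measurable_to_row => i; under eq_fun do rewrite mxE.
case: (P i); last exact: measurable_coord.
by apply: measurable_funM => //; exact: measurable_coord.
Qed.

Local Open Scope ereal_scope.

Let kappa := H (cube 1).
Let delta := fun i => H (dilate (pred1 i) @^-1` cube 1).

Let mpre P (A : set V) : measurable A -> measurable (dilate P @^-1` A : set V).
Proof. by move=> mA; rewrite -[X in measurable X]setTI; apply: measurable_dilate. Qed.

Let step i (A : set V) : measurable A -> H A * delta i = kappa * H (dilate (pred1 i) @^-1` A).
Proof.
move=> mA.
exact: (hausdorff_fubini (dilateD _) (dilate_surj _) (measurable_dilate _) mA (measurable_cube 1)).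
Qed.

(** Exchanging two coordinates is an isometry that preserves the cube. *)
Let delta_const i j : delta i = delta j.
Proof.
rewrite /delta.
pose s : {perm 'I_n} := tperm i j.
pose f (x : 'rV[R]_n) : 'rV[R]_n := \row_k x 0%R (s k).
have fK x : f (f x) = x by apply/rowP => k; rewrite !mxE tpermK.
have cube_f x : cube 1 (f x) -> cube 1 x.
  by move=> fx k; have := fx (s k); rewrite mxE tpermK.
have dilate_f x : dilate (pred1 i) (f x) = f (dilate (pred1 j) x).
  apply/rowP => k; rewrite !mxE /=; congr (if _ then _ else _).
  by rewrite -[X in _ = (_ == X)](tpermL i j) (inj_eq perm_inj).
have -> : dilate (pred1 i) @^-1` cube 1 = f @` (dilate (pred1 j) @^-1` cube 1) :> set 'rV[R]_n.
  apply/seteqP; split=> [x /= xi|_ [x /= xj <-]].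
    by exists (f x) => //=; apply: cube_f; rewrite -dilate_f fK.
  by apply: cube_f; rewrite /= dilate_f fK.
rewrite -[in RHS](image_id (dilate (pred1 j) @^-1` cube 1)); apply: hausdorff_isometry => x y _ _.
rewrite /enorm; congr Num.sqrt; rewrite /dot [RHS](reindex_inj (@perm_inj _ s)).
by apply: eq_bigr => k _; rewrite !mxE.
Qed.

Let kappa_fin : kappa \is a fin_num.
Proof. by rewrite ge0_fin_numE ?hausdorff_cube_lty// hausdorff_ge0. Qed.

Let delta_fin i : delta i \is a fin_num.
Proof.
rewrite ge0_fin_numE ?hausdorff_ge0//.
have r0 : (0 < 1 + c^-1)%R by rewrite addr_gt0// invr_gt0.
apply: (@le_lt_trans _ _ (H (cube (1 + c^-1)%R))); last first.
  by rewrite hausdorff_cubeE// lte_mul_pinfty ?hausdorff_cube_lty// lee_fin exprn_ge0// ltW.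
apply: le_hausdorff => x /= xi k; have := xi k; rewrite mxE /=; case: ifP => _ xk; last first.
  by apply: lt_trans xk _; rewrite ltrDl invr_gt0.
rewrite normrM gtr0_norm// mulrC -ltr_pdivlMr// mul1r in xk.
by apply: lt_trans xk _; rewrite ltrDr.
Qed.

Let iter_step i (A : set V) k : measurable A -> (k <= n)%N ->
  H A * ((fine (delta i)) ^+ k)%:E =
  ((fine kappa) ^+ k)%:E * H (dilate (fun j => (j < k)%N) @^-1` A).
Proof.
move=> mA; elim: k => [_|k ih kn].
  rewrite !expr0 mule1 mul1e; congr (H _); apply/seteqP; split=> x /=;
    by rewrite (_ : dilate _ x = x)//; apply/rowP => j; rewrite mxE.
pose ik := Ordinal kn.
rewrite exprSr EFinM muleA ih ?(ltnW kn)// fineK// -muleA (delta_const i ik) step; last exact: mpre.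
rewrite exprSr EFinM fineK// -muleA; congr (_ * (_ * H _)).
have dd x : dilate (fun j => (j < k)%N) (dilate (pred1 ik) x) = dilate (fun j => (j < k.+1)%N) x.
  apply/rowP => j; rewrite !mxE ltnS [in RHS]leq_eqVlt /=.
  by have -> : (j == ik) = (j == k :> nat) by []; case: eqVneq => [->|_]; rewrite ?ltnn.
by apply/seteqP; split=> x /=; rewrite dd.
Qed.

(** Stretching all n coordinates one after the other multiplies the measure of preimages by (delta /
    kappa)^n, while homogeneity gives c^-n; hence delta = kappa / c. *)
Lemma hausdorff_dilate1 i (A : set V) : measurable A ->
  H (dilate (pred1 i) @^-1` A) = (c^-1)%:E * H A.
Proof.
move=> mA; have n0 : (0 < n)%N by case: n i => [[]|].
(* If the unit cube were null, so would be every set, being covered by countably many cubes. *)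
have [k0|k0] := eqVneq kappa 0.
  have cube0 r : (0 < r)%R -> H (cube r) = 0 by move=> r0; rewrite hausdorff_cubeE// -/kappa k0 mule0.
  have H0 B : H B = 0.
    apply/eqP; rewrite eq_le hausdorff_ge0 andbT.
    have <- : \sum_(k <oo) H (cube k.+1%:R) = 0 by apply: eseries0 => k _ _; rewrite cube0.
    apply: le_trans (hausdorff_sigma_subadditive n (fun k => cube k.+1%:R)).
    apply: le_hausdorff => x _; exists (Num.truncn (enorm x)) => // j.
    by apply: le_lt_trans (coord_le_enorm x j) _; exact: truncnS_gt.
  by rewrite !H0 mule0.
have kpos : (0 < fine kappa)%R by rewrite fine_gt0// lt0e k0 hausdorff_ge0 /= -ge0_fin_numE ?hausdorff_ge0.
have dE : fine (delta i) = (fine kappa / c)%R.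
  have := iter_step i (measurable_cube 1) (leqnn n).
  rewrite -/kappa.
  have -> : dilate (fun j => (j < n)%N) @^-1` cube 1 = [set x : 'rV[R]_n | cube 1 (c *: x)].
    by apply/seteqP; split=> x /=; rewrite (_ : dilate _ x = c *: x)//;
      apply/rowP => j; rewrite !mxE ltn_ord.
  rewrite hausdorff_scale// -/kappa -(fineK kappa_fin) -!EFinM => -[].
  rewrite mulrCA mulrA mulrC => /(mulIf (lt0r_neq0 kpos)).
  rewrite -exprVn -exprMn mulrC => /eqP.
  rewrite eqrXn2// ?fine_ge0 ?hausdorff_ge0//; first by move/eqP.
  by rewrite divr_ge0 ?fine_ge0 ?hausdorff_ge0// ltW.
have := step i mA; rewrite -(fineK (delta_fin i)) dE -(fineK kappa_fin).
move=> /(congr1 (fun z => (fine kappa)^-1%:E * z)).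
rewrite [RHS]muleA -EFinM mulVf ?gt_eqF// mul1e => <-.
by rewrite muleCA -EFinM mulrA mulVf ?gt_eqF// mul1r muleC.
Qed.

End hausdorff_dilation.

(** * Hyperplanes *)

Section reflection.
Context {R : realType} {n : nat}.
Implicit Types (w x y a b : 'rV[R]_n).

(* the identity when [w = 0], since then [2 / dot w w = 0] *)
Definition householder w x : 'rV[R]_n := x - (2 * dot x w / dot w w) *: w.

Lemma householder_dot w x y : dot (householder w x) (householder w y) = dot x y.
Proof.
rewrite /householder; have [->|w0] := eqVneq w 0; first by rewrite !scaler0 !subr0.
by rewrite !dotE (dotC w y); field; rewrite dotvv_eq0.
Qed.

Lemma householderB w x y : householder w (x - y) = householder w x - householder w y.
Proof. by apply/rowP => i; rewrite /householder !dotE !mxE; ring. Qed.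

Lemma householderK w : involutive (householder w).
Proof.
move=> x; rewrite /householder; have [->|w0] := eqVneq w 0; first by rewrite !scaler0 !subr0.
by apply/rowP => i; rewrite !dotE !mxE; field; rewrite dotvv_eq0.
Qed.

Lemma householder_enorm w x : enorm (householder w x) = enorm x.
Proof. by rewrite /enorm householder_dot. Qed.

Lemma householder_swap a b : dot a a = dot b b -> householder (a - b) a = b.
Proof.
move=> ab; have [/eqP|ab0] := eqVneq (a - b) 0.
  by rewrite subr_eq0 => /eqP ->; rewrite /householder subrr scaler0 subr0.
apply/eqP; rewrite -subr_eq0 /householder.
have -> : 2 * dot a (a - b) / dot (a - b) (a - b) = 1.
  have : dot (a - b) (a - b) != 0 by rewrite dotvv_eq0.
  rewrite !dotE (dotC b a) -ab => d0; field.
  by move: d0; congr (_ != _); ring.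
by rewrite scale1r opprB addrCA subrr addr0 subrr.
Qed.

End reflection.

Section row_measurable_maps.
Context {R : realType}.

Lemma measurable_row_dot n d (T : measurableType d) (f : T -> @row_type R n) (w : 'rV[R]_n) :
  measurable_fun setT f -> measurable_fun setT (fun t => dot (f t) w : R).
Proof.
move=> mf; rewrite /dot; apply: measurable_sum => i; apply: measurable_funM => //.
exact: (measurableT_comp (measurable_coord i) mf).
Qed.

Lemma measurable_householder n (w : 'rV[R]_n) :
  measurable_fun setT (householder w : @row_type R n -> @row_type R n).
Proof.
apply: measurable_to_row => i; under eq_fun do rewrite !mxE.
apply: measurable_funB; first exact: measurable_coord.
apply: measurable_funM => //; apply: measurable_funM => //; apply: measurable_funM => //.
exact: measurable_row_dot.
Qed.

Lemma measurable_row_mx n (f : @row_type R n -> R) : measurable_fun setT f ->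
  measurable_fun setT (fun u => row_mx (f u)%:M (u : 'rV[R]_n) : @row_type R (1 + n)).
Proof.
move=> mf; apply: measurable_to_row => i; rewrite -[i]splitK.
case: (fintype.split i) => j /=; under eq_fun do rewrite ?row_mxEl ?row_mxEr.
  by rewrite !ord1; under eq_fun do rewrite mxE eqxx mulr1n.
exact: measurable_coord.
Qed.

End row_measurable_maps.

Section hyperplane_chart.
Context {R : realType} {n : nat}.
Local Notation d := n.+2.
Variable e : 'rV[R]_d.
Hypothesis e1 : dot e e = 1.

Let e0 : 'rV[R]_(1 + n.+1) := row_mx 1%:M 0.

Let dot_row_mx (a b : R) (u v : 'rV[R]_n.+1) :
  dot (row_mx a%:M u : 'rV[R]_(1 + n.+1)) (row_mx b%:M v) = a * b + dot u v.
Proof.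
rewrite /dot big_split_ord /= big_ord1 !row_mxEl !mxE !mulr1n; congr (_ + _).
by apply: eq_bigr => i _; rewrite !row_mxEr.
Qed.

(** The reflection exchanging e and the first basis vector; as an involution it is its own inverse
    change of coordinates. *)
Let rho := householder (e0 - e : 'rV[R]_(1 + n.+1)).

Let rho_e0 : rho e0 = e.
Proof. by apply: householder_swap; rewrite e1 dot_row_mx dot0l mulr1 addr0. Qed.

Let rho_e : rho e = e0. Proof. by rewrite -[in LHS]rho_e0 /rho householderK. Qed.

(* Orthonormal coordinates (t, u) with first axis e. *)
Definition line_pt (u : 'rV[R]_n.+1) (t : R) : 'rV[R]_d := rho (row_mx t%:M u).

Definition tangential (x : 'rV[R]_d) : 'rV[R]_n.+1 := rsubmx (rho x : 'rV[R]_(1 + n.+1)).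

Let dot_e (x : 'rV[R]_d) : dot x e = (rho x : 'rV[R]_(1 + n.+1)) 0 (lshift n.+1 0).
Proof.
rewrite -[LHS](householder_dot (e0 - e)) -/rho rho_e.
rewrite -[in LHS](hsubmxK (rho x : 'rV[R]_(1 + n.+1))) (mx11_scalar (lsubmx _)) dot_row_mx.
by rewrite dotC dot0l mulr1 addr0 !mxE.
Qed.

Lemma dot_line_pt (x : 'rV[R]_d) u t : dot x (line_pt u t) = t * dot x e + dot (tangential x) u.
Proof.
rewrite dot_e.
rewrite -[LHS](householder_dot (e0 - e)) /line_pt householderK -/rho.
rewrite -[in LHS](hsubmxK (rho x : 'rV[R]_(1 + n.+1))) (mx11_scalar (lsubmx _)) dot_row_mx.
by rewrite mulrC mxE.
Qed.

Lemma line_pt_dot u t : dot (line_pt u t) (line_pt u t) = t ^+ 2 + dot u u.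
Proof. by rewrite /line_pt householder_dot; exact: dot_row_mx. Qed.

Lemma line_ptB u v t t' :
  dot (line_pt u t - line_pt v t') (line_pt u t - line_pt v t') =
  (t - t') ^+ 2 + dot (u - v) (u - v).
Proof.
have E : (row_mx t%:M u - row_mx t'%:M v : 'rV[R]_(1 + n.+1)) = row_mx (t - t')%:M (u - v).
  by rewrite opp_row_mx add_row_mx -scalemx1 -[t'%:M]scalemx1 -scalerBl scalemx1.
pose D := (row_mx t%:M u - row_mx t'%:M v : 'rV[R]_(1 + n.+1)).
by rewrite /line_pt -householderB householder_dot -[LHS]/(dot D D) /D E dot_row_mx expr2.
Qed.

Lemma line_pt_surj (x : 'rV[R]_d) : line_pt (tangential x) (dot x e) = x.
Proof.
rewrite dot_e /line_pt /tangential -[RHS](householderK (e0 - e)) -/rho; congr rho.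
rewrite -[RHS](hsubmxK (rho x : 'rV[R]_(1 + n.+1))) (mx11_scalar (lsubmx _)).
by rewrite [in RHS]mxE.
Qed.

Lemma tangential_dot (x y : 'rV[R]_d) :
  dot x y = dot x e * dot y e + dot (tangential x) (tangential y).
Proof. by rewrite -{1}(line_pt_surj y) dot_line_pt mulrC. Qed.

End hyperplane_chart.

Section hyperplane_area.
Context {R : realType} {n : nat}.
Local Notation d := n.+2.
Variables (e xi : 'rV[R]_d) (c : R).
Hypotheses (e1 : dot e e = 1) (xi1 : dot xi xi = 1) (xe : dot xi e != 0).

(** The hyperplane xi . x = c is a graph over the orthogonal complement of e; this is the t solving
    the equation at u. *)
Definition chart_height (u : 'rV[R]_n.+1) : R := (c - dot (tangential e xi) u) / dot xi e.

Definition chart (u : 'rV[R]_n.+1) : 'rV[R]_d := line_pt e u (chart_height u).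

Lemma line_pt_plane u t : dot xi (line_pt e u t) = c -> t = chart_height u.
Proof. by rewrite dot_line_pt// /chart_height => <-; rewrite addrK mulfK. Qed.

Lemma plane_chart x : dot xi x = c -> chart (tangential e x) = x.
Proof.
move=> xc; rewrite -[RHS](line_pt_surj e1) /chart; congr line_pt.
by apply/esym/line_pt_plane; rewrite line_pt_surj.
Qed.

Let chartB u v : dot (chart u - chart v) (chart u - chart v) =
  (dot (tangential e xi) (u - v) / dot xi e) ^+ 2 + dot (u - v) (u - v).
Proof.
by rewrite line_ptB//; congr (_ + _); rewrite /chart_height dotDr dotNr; field.
Qed.

(** Projecting along e does not increase distances, so null subsets of a face have null
    projections. *)
Lemma chart_expanding u v : enorm (u - v) <= enorm (chart u - chart v).
Proof. by rewrite /enorm ler_wsqrtr// chartB lerDr sqr_ge0. Qed.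

Lemma measurable_chart_height : measurable_fun setT (chart_height : @row_type R n.+1 -> R).
Proof.
apply: measurable_funM => //; apply: measurable_funB => //.
have -> : dot (tangential e xi) = (fun u => dot u (tangential e xi)) by apply/funext => u; rewrite dotC.
by apply: measurable_row_dot; exact: measurable_id.
Qed.

Lemma measurable_chart : measurable_fun setT (chart : @row_type R n.+1 -> @row_type R d).
Proof.
apply: (measurableT_comp (@measurable_householder R d _)).
apply: measurable_row_mx; exact: measurable_chart_height.
Qed.

(* Up to isometries of both sides, the chart stretches one coordinate by the
   factor [1 / |xi . e|]. *)
Lemma hausdorff_chart (S : set (@row_type R n.+1)) : measurable S ->
  hausdorff n.+1 (chart @` S) = (`|dot xi e|^-1%:E * hausdorff n.+1 S)%E.
Proof.
move=> mS; pose a := `|dot xi e|; have a0 : 0 < a by rewrite normr_gt0.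
pose f0 : 'rV[R]_n.+1 := delta_mx 0 0.
pose eta := tangential e xi.
pose r : 'rV[R]_n.+1 -> 'rV[R]_n.+1 := householder (eta - enorm eta *: f0).
have f01 : dot f0 f0 = 1.
  rewrite /dot (bigD1 0)//= big1 ?addr0 ?mxE ?eqxx ?mulr1// => i /negbTE i0.
  by rewrite !mxE i0 andbF mul0r.
have f0E x : dot f0 x = x 0 0.
  rewrite /dot (bigD1 0)//= big1 ?addr0 ?mxE ?eqxx ?mul1r// => i /negbTE i0.
  by rewrite !mxE i0 andbF mul0r.
have eta2 : enorm eta ^+ 2 = 1 - a ^+ 2.
  rewrite sqr_sqrtr ?dotvv_ge0// -xi1 (tangential_dot e1 xi xi) real_normK ?num_real//.
  by rewrite expr2 addrC addKr.
have r_eta : r eta = enorm eta *: f0.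
  apply: householder_swap; rewrite dotZl dotZr f01 mulr1 -expr2 sqr_sqrtr//.
  exact: dotvv_ge0.
have mrS : measurable (r @^-1` S : set (@row_type R n.+1)).
  by rewrite -[X in measurable X]setTI; apply: measurable_householder.
(* After the reflection [r] takes eta to the first axis, |chart u - chart v|^2 contains the first
   coordinate squared with coefficient (1 - a^2) / a^2 + 1 = a^-2, and the others with coefficient
   1. *)
have -> : hausdorff n.+1 (chart @` S) = hausdorff n.+1 ((dilate a^-1 (pred1 0) \o r) @` S).
  apply: hausdorff_isometry => u v _ _; rewrite /enorm; congr Num.sqrt.
  rewrite chartB -/eta.
  have -> : dot eta (u - v) = enorm eta * (r (u - v)) 0 0.
    by rewrite -[LHS](householder_dot (eta - enorm eta *: f0)) -/r r_eta dotZl f0E.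
  rewrite -[X in _ + X](householder_dot (eta - enorm eta *: f0)) -/r [r (u - v)]householderB -/(r u) -/(r v).
  have -> : dilate a^-1 (pred1 0) (r u) - dilate a^-1 (pred1 0) (r v) =
      dilate a^-1 (pred1 0) (r u - r v).
    by apply/rowP => i; rewrite !mxE; case: ifP => _ //; ring.
  move: (r u - r v) => w.
  rewrite expr_div_n -[dot xi e ^+ 2]real_normK ?num_real// -/a exprMn eta2.
  rewrite /dot !(bigD1 0 (P := xpredT))//= !mxE /= addrA; congr (_ + _); last first.
    by apply: eq_bigr => i /negbTE i0; rewrite !mxE /= i0.
  by field; rewrite gt_eqF.
have -> : (dilate a^-1 (pred1 0) \o r) @` S = dilate a (pred1 0) @^-1` (r @^-1` S).
  apply/seteqP; split=> [_ [u Su <-]|u /= Su].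
    rewrite /= (_ : dilate _ _ (dilate _ _ _) = r u) ?/r ?householderK//.
    apply/rowP => i; rewrite !mxE; case: (pred1 0 i) => //.
    by rewrite mulrA divff ?mul1r// gt_eqF.
  exists (r (dilate a (pred1 0) u)) => //=; rewrite /r householderK.
  apply/rowP => i; rewrite !mxE; case: (pred1 0 i) => //.
  by rewrite mulrA mulVf ?mul1r// gt_eqF.
rewrite hausdorff_dilate1//; congr (_ * _)%E.
have -> : r @^-1` S = r @` S.
  apply/seteqP; split=> [u Su|_ [u Su <-]]; last by rewrite /= /r householderK.
  by exists (r u) => //; rewrite /r householderK.
rewrite -[in RHS](image_id S); apply: hausdorff_isometry => u v _ _.
by rewrite -householderB householder_enorm.
Qed.

End hyperplane_area.

(** * Closed surfaces *)

Section crossing.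
Context {R : realType}.

Lemma locally_constant (T : Type) (f : R -> T) :
  (forall t, exists2 e, 0 < e & forall t', `|t' - t| < e -> f t' = f t) ->
  forall a b, f a = f b.
Proof.
move=> floc a b; pose B := [set t | f t = f a].
suff : B = setT by move=> /seteqP[_ /(_ b I)].
have cR : connected [set: R] by apply/connected_intervalP.
apply: cR; first by exists a.
- exists B; last by rewrite setTI.
  rewrite openE => t Bt; have [e e0 fe] := floc t.
  by apply/nbhs_ballP; exists e => // t'; rewrite /ball/= distrC => /fe; rewrite /B/= Bt.
exists B; last by rewrite setTI.
rewrite -[B]setCK; apply: open_closedC; rewrite openE => t Bt; have [e e0 fe] := floc t.
by apply/nbhs_ballP; exists e => // t'; rewrite /ball/= distrC => /fe fE Bt'; apply: Bt; rewrite /B/= -fE.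
Qed.

Lemma seq_gap (I : eqType) (J : seq I) (tau : I -> R) t :
  exists2 e, 0 < e & forall j, j \in J -> tau j != t -> e <= `|tau j - t|.
Proof.
elim: J => [|j J [e e0 ih]]; first by exists 1.
have [tj|tj] := eqVneq (tau j) t.
  by exists e => // i; rewrite inE => /predU1P[->|/ih//]; rewrite tj eqxx.
exists (Num.min e `|tau j - t|); first by rewrite lt_min e0 normr_gt0 subr_eq0.
move=> i; rewrite inE ge_min => /predU1P[->|/ih ih' /ih' ->//].
by rewrite lexx orbT.
Qed.

(* chi is the trace of a set along a line, tau j the position of the j-th
   crossing of its boundary, and s j tells whether the set is left there. *)
Lemma sum_crossing (I : eqType) (J : seq I) (tau : I -> R) (s : pred I) (chi : R -> bool) (T : R) :
  uniq J -> {in J &, injective tau} ->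
  (forall t, (forall j, j \in J -> tau j != t) ->
    exists2 e, 0 < e & forall t', `|t' - t| < e -> chi t' = chi t) ->
  (forall j, j \in J -> exists2 e, 0 < e & forall t', `|t' - tau j| < e ->
    (t' < tau j -> chi t' = s j) /\ (tau j < t' -> chi t' = ~~ s j)) ->
  (forall t, T < `|t| -> chi t = false) ->
  \sum_(j <- J) (if s j then 1 else -1) = 0 :> R.
Proof.
move=> uJ tinj hreg hcross hfar.
pose sg j : R := if s j then 1 else -1.
(* At a crossing, [c] takes the value of chi just before it. Each jump of chi by - sg j is then
   compensated by the sum in [g], so [g] is locally constant; it is 0 far to the left and the full
   sum far to the right. *)
pose cross t := has (fun j => tau j == t) J.
pose c t := if cross t then has (fun j => (tau j == t) && s j) J else chi t.
pose g t : R := (c t)%:R + \sum_(j <- J) (if tau j < t then sg j else 0).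
have cE j : j \in J -> c (tau j) = s j.
  move=> jJ; rewrite /c; have -> : cross (tau j) by apply/hasP; exists j.
  apply/hasP/idP => [[i iJ /andP[/eqP ij si]]|sj]; first by rewrite -(tinj _ _ iJ jJ ij).
  by exists j; rewrite ?eqxx.
have gloc t : exists2 e, 0 < e & forall t', `|t' - t| < e -> g t' = g t.
  have [e0 e00 gap] := seq_gap J tau t.
  have cNt t' : `|t' - t| < e0 -> t' != t -> c t' = chi t'.
    move=> tt' t't; rewrite /c ifF//; apply/negbTE/hasPn => j jJ.
    apply: contra_neqN t't => /eqP tj; apply/eqP; rewrite -tj.
    by apply: contraTT tt' => tjt; rewrite -leNgt -tj gap.
  have side t' j : j \in J -> `|t' - t| < e0 -> tau j != t -> (tau j < t') = (tau j < t).
    move=> jJ tt' tjt; have := gap j jJ tjt; move: tt'.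
    have [tj|tj] := ltP (tau j) t.
      rewrite [X in _ <= X]distrC [X in _ <= X]gtr0_norm ?subr_gt0// ltr_norml => /andP[? ?] ?.
      by apply/idP; lra.
    rewrite [X in _ <= X]ger0_norm ?subr_ge0// ltr_norml => /andP[? ?] ?.
    by apply/negbTE; rewrite -leNgt; lra.
  have [/hasP[j jJ /eqP tj]|/hasPn nocross] := boolP (cross t); last first.
    have [e1 e10 he1] := hreg t nocross.
    exists (Num.min e0 e1); first by rewrite lt_min e00.
    move=> t'; rewrite lt_min => /andP[t0 t1].
    have [->//|t't] := eqVneq t' t.
    rewrite /g (cNt _ t0 t't) he1// /c ifF; last by apply/negbTE/hasPn.
    congr (_ + _); rewrite !big_seq; apply: eq_bigr => j jJ.
    by rewrite (side t' j) ?nocross.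
  have [e1 e10 he1] := hcross j jJ.
  exists (Num.min e0 e1); first by rewrite lt_min e00.
  move=> t'; rewrite lt_min => /andP[t0 t1].
  have [->//|t't] := eqVneq t' t.
  rewrite /g (cNt _ t0 t't) -tj cE// !(bigD1_seq j)//= ltxx.
  have -> : \sum_(i <- J | i != j) (if tau i < t' then sg i else 0) =
      \sum_(i <- J | i != j) (if tau i < tau j then sg i else 0).
    rewrite big_seq_cond [RHS]big_seq_cond; apply: eq_bigr => i /andP[iJ ij].
    rewrite tj side// -tj; apply: contra_neq ij; exact: tinj.
  rewrite !addrA; congr (_ + _).
  have [l r] : (t' < tau j -> chi t' = s j) /\ (tau j < t' -> chi t' = ~~ s j).
    by apply: he1; rewrite tj.
  have [tlt|tgt|/eqP] := ltgtP t' (tau j); last by rewrite tj (negbTE t't).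
    by rewrite l//.
  by rewrite r// /sg; case: (s j); rewrite /= ?add0r ?addr0 ?subrr.
pose b := `|T| + 1 + \sum_(j <- J) `|tau j|.
have tb j : j \in J -> `|tau j| < b.
  move=> jJ; have : `|tau j| <= \sum_(i <- J) `|tau i|.
    by rewrite (bigD1_seq j)//= lerDl sumr_ge0.
  by have := normr_ge0 T; rewrite /b; lra.
have sum0 : 0 <= \sum_(j <- J) `|tau j| by rewrite sumr_ge0.
have b0 : 0 < b by have := normr_ge0 T; rewrite /b; lra.
have Tb : T < b by have := ler_norm T; rewrite /b; lra.
have far t : `|t| = b -> c t = false.
  move=> tb'; rewrite /c ifF ?hfar ?tb'//; apply/negbTE/hasPn => j jJ.
  by apply/eqP => tj; have := tb j jJ; rewrite tj tb' ltxx.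
have Sb : \sum_(j <- J) (if tau j < b then sg j else 0) = \sum_(j <- J) sg j.
  rewrite !big_seq; apply: eq_bigr => j jJ.
  by rewrite ifT//; apply: le_lt_trans (ler_norm _) (tb j jJ).
have SNb : \sum_(j <- J) (if tau j < - b then sg j else 0) = 0.
  rewrite big_seq big1// => j jJ; rewrite ifF//; apply/negbTE; rewrite -leNgt.
  by have := tb j jJ; rewrite ltr_norml => /andP[/ltW].
by have := locally_constant gloc b (- b); rewrite /g !far ?normrN ?gtr0_norm// !add0r Sb SNb.
Qed.

End crossing.

Section enorm_topology.
Context {R : realType} {n : nat}.
Implicit Types (x y : 'rV[R]_n) (A : set 'rV[R]_n).

(** The topology comes from the sup norm, the metric from the Euclidean one. The + 1 next to sqrt n
    in the radius avoids a zero denominator at n = 0. *)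
Lemma nbhs_enormP x A :
  nbhs x A <-> exists2 e, 0 < e & forall y, enorm (y - x) < e -> A y.
Proof.
split=> [/nbhs_ballP[e /= e0 xA]|[e e0 xA]].
  exists e => // y yx; apply/xA/ball_rowP => // i; rewrite distrC.
  by apply: le_lt_trans yx; have := coord_le_enorm (y - x) i; rewrite !mxE.
have r0 : 0 < Num.sqrt (n%:R : R) + 1 by rewrite ltr_pwDr// sqrtr_ge0.
apply/nbhs_ballP; exists (e / (Num.sqrt n%:R + 1)) => /=; first by rewrite divr_gt0.
move=> y /ball_rowP; rewrite divr_gt0// => /(_ isT) xy; apply: xA.
apply: (@le_lt_trans _ _ (Num.sqrt n%:R * (e / (Num.sqrt n%:R + 1)))).
  by apply: enorm_le_coord => i; rewrite !mxE distrC ltW.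
by rewrite mulrA ltr_pdivrMr// mulrC ltr_pM2l// ltrDl.
Qed.

Lemma enormD x y : enorm (x + y) <= enorm x + enorm y.
Proof.
have xy0 : 0 <= enorm x + enorm y by rewrite addr_ge0// sqrtr_ge0.
have xy : dot x y <= enorm x * enorm y.
  apply: le_trans (ler_norm _) _.
  rewrite -ler_sqr ?nnegrE ?mulr_ge0 ?sqrtr_ge0// real_normK ?num_real// exprMn.
  by rewrite !sqr_sqrtr ?dotvv_ge0// cauchy_schwarz_dot.
rewrite -ler_sqr ?nnegrE ?sqrtr_ge0// sqrrD !sqr_sqrtr ?dotvv_ge0//.
by rewrite !dotE (dotC y x); lra.
Qed.

Lemma dot_le_enorm x y : enorm x = 1 -> `|dot x y| <= enorm y.
Proof.
move=> x1; rewrite -ler_sqr ?nnegrE ?sqrtr_ge0// real_normK ?num_real//.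
have xx : dot x x = 1 by rewrite -[LHS]sqr_sqrtr ?dotvv_ge0// -/(enorm x) x1 expr1n.
by rewrite sqr_sqrtr ?dotvv_ge0// -[leRHS]mul1r -xx cauchy_schwarz_dot.
Qed.

End enorm_topology.

Section polytope_facts.
Context {R : realType} {d : nat}.
Implicit Types A B : set 'rV[R]_d.

Lemma polytope_closed A : polytope A -> closed A.
Proof. by case=> _ _ rA _; rewrite -rA; exact: closed_closure. Qed.

Lemma polytope_bounded A : polytope A -> exists r, forall x, A x -> enorm x <= r.
Proof.
case=> -[P ->] _ _ _.
exists (\sum_(s <- P) \sum_(v <- s) enorm v) => x [s /= sP [a [a0 a1 ->]]].
rewrite (big_rem s)//= -[leLHS]addr0 lerD//; last first.
  by rewrite sumr_ge0// => t _; rewrite sumr_ge0// => v _; exact: sqrtr_ge0.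
rewrite (big_nth 0) big_mkord; apply: (@le_trans _ _ (\sum_i enorm (a i *: s`_i))).
  elim/big_ind2: _ => [|u b v c ub vc|//]; first by rewrite /enorm dot0l sqrtr0.
  by apply: le_trans (enormD _ _) _; exact: lerD.
apply: ler_sum => i _; rewrite enormZ ger0_norm// ler_piMl ?sqrtr_ge0//.
by rewrite -a1 (bigD1 i)//= lerDl sumr_ge0.
Qed.

Lemma boundary_closed A : closed (boundary A).
Proof. by apply: closedI; [exact: closed_closure|exact/open_closedC/open_interior]. Qed.

(** On the outer side B is a neighbourhood of each point. As A is the closure of its interior, which
    is disjoint from that of B, such a point is outside A. *)
Lemma outward_sides A B (xi x : 'rV[R]_d) : polytope A -> A° `&` B° = set0 ->
  enorm xi = 1 -> outward A B xi x ->
  exists2 e, 0 < e & forall y, enorm (y - x) < e ->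
    (dot xi (y - x) < 0 -> A y) /\ (0 < dot xi (y - x) -> B° y /\ ~ A y).
Proof.
move=> pA AB xi1 /nbhs_enormP[e e0 xe]; exists e => // y yx; split; first by apply: (xe y yx).1.
move=> xiy; have By : B° y.
  apply/nbhs_enormP; exists (Num.min (e - enorm (y - x)) (dot xi (y - x))).
    by rewrite lt_min subr_gt0 yx.
  move=> z; rewrite lt_min => /andP[zy1 zy2]; have zx : z - x = (z - y) + (y - x) by rewrite subrKA.
  apply: (xe z _).2; first by rewrite zx; apply: le_lt_trans (enormD _ _) _; lra.
  rewrite zx dotDr; have := dot_le_enorm (z - y) xi1; rewrite ler_norml => /andP[? _]; lra.
split => // Ay; have : closure A° y by case: pA => _ _ -> _.
by move=> /(_ _ (open_nbhs_nbhs (conj (@open_interior _ B) By)))[z]; rewrite AB.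
Qed.

End polytope_facts.

Section generic_direction.
Context {R : realType} {n : nat}.

(** A vector v suited to the tail of the list is corrected to v + t w, with t larger than every
    ratio |u.v / u.w|, so that no product cancels. *)
Lemma nonorthogonal (l : seq 'rV[R]_n) : (forall w, w \in l -> w != 0) ->
  exists v, forall w, w \in l -> dot w v != 0.
Proof.
elim: l => [|w l ih] l0; first by exists 0.
have [|v vl] := ih; first by move=> u ul; apply: l0; rewrite inE ul orbT.
have w0 : w != 0 by apply: l0; rewrite inE eqxx.
pose t := 1 + \sum_(u <- l) `|dot u v / dot u w| + `|dot w v / dot w w|.
have tP u : u \in w :: l -> (dot u w != 0) || (dot u v != 0) -> dot u (v + t *: w) != 0.
  move=> uwl; have [uw0|uw0 _] := eqVneq (dot u w) 0.
    by rewrite dotDr dotZr uw0 mulr0 addr0.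
  have tu : `|dot u v / dot u w| < t.
    have sum0 : 0 <= \sum_(z <- l) `|dot z v / dot z w| by rewrite sumr_ge0.
    have abs0 := normr_ge0 (dot w v / dot w w).
    move: uwl; rewrite inE => /predU1P[->|ul]; first by rewrite /t; lra.
    have : `|dot u v / dot u w| <= \sum_(z <- l) `|dot z v / dot z w|.
      by rewrite (big_rem u)//= lerDl sumr_ge0.
    by rewrite /t; lra.
  apply/eqP; rewrite dotDr dotZr => /eqP; rewrite addr_eq0 => /eqP uv.
  by move: tu; rewrite uv -mulNr mulfK// normrN; apply/negP; rewrite -leNgt ler_norm.
exists (v + t *: w) => u uwl; apply: tP => //; move: uwl; rewrite inE => /predU1P[->|/vl ->].
  by rewrite dotvv_eq0 w0.
by rewrite orbT.
Qed.

End generic_direction.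

Lemma integral_sum_indic d (T : measurableType d) (R : realType) (mu : {measure set T -> \bar R})
    (I : Type) (r : seq I) (P : pred I) (D : I -> set T) : (forall i, measurable (D i)) ->
  (\int[mu]_x (\sum_(i <- r | P i) \1_(D i) x)%:E = \sum_(i <- r | P i) mu (D i))%E.
Proof.
move=> mD; under eq_integral do rewrite -sumEFin -big_filter.
rewrite ge0_integral_sum//; last by move=> i; apply/measurable_EFinP; exact: measurable_indic.
by rewrite -[RHS]big_filter; apply: eq_bigr => i _; rewrite integral_indic// setIT.
Qed.

Section closed_surface.
Context {R : realType} {n : nat} (M : mesh R n.+2) (k : M).
Variable e : 'rV[R]_n.+2.
Hypothesis e1 : dot e e = 1.
Hypothesis transverse : forall j, j \in nbr k -> dot (normal k j) e != 0.

Local Notation A := (cell k).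
Local Notation xi j := (normal k j).

Let offset j : R := xget 0 [set c | forall x, face k j x -> dot (xi j) x = c].

Let offsetP j x : j \in nbr k -> face k j x -> dot (xi j) x = offset j.
Proof.
move=> jk; have [c cP] := face_flat jk.
exact: (@xgetPex _ 0 [set c | forall x, face k j x -> dot (xi j) x = c] (ex_intro _ c cP)).
Qed.

Let height j := chart_height e (xi j) (offset j).
Let ch j := chart e (xi j) (offset j).
(** The projection of the face along e, in the coordinates u; [tilted j] is the part of it above
    which the face fails to be outward. *)
Let S j : set (@row_type R n.+1) := ch j @^-1` face k j.
Let tilted j := ch j @^-1` (face k j `\` [set x | outward A (cell j) (xi j) x]).

Let polyA : polytope A. Proof. by have [] := cell_polytope k. Qed.

Let xi1 j : j \in nbr k -> dot (xi j) (xi j) = 1.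
Proof.
by move=> jk; rewrite -[LHS]sqr_sqrtr ?dotvv_ge0// -/(enorm _) (normal_unit jk) expr1n.
Qed.

Let faceE j : j \in nbr k -> face k j = ch j @` S j.
Proof.
move=> jk; apply/seteqP; split=> [x Fx|_ [u Su <-]//].
have chx : ch j (tangential e x) = x by apply: plane_chart => //; [exact: transverse|exact: offsetP].
by exists (tangential e x) => //; rewrite /S /= chx.
Qed.

Let measurable_S j : measurable (S j).
Proof.
rewrite -[X in measurable X]setTI; apply: measurable_chart => //.
by apply: measurable_row_closed; apply: closedI; exact: boundary_closed.
Qed.

Let hausdorff_S_lty j : (hausdorff n.+1 (S j) < +oo)%E.
Proof.
have [r Ar] := polytope_bounded polyA.
have r0 : 0 < `|r| + 1 by rewrite ltr_pwDr.
apply: (@le_lt_trans _ _ (hausdorff n.+1 (cube (`|r| + 1) : set 'rV[R]_n.+1))).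
  apply: le_hausdorff => u [[cAu _] _] i; rewrite (closure_id A).1 in Ar; last first.
    exact: polytope_closed.
  have := Ar _ cAu => ur; apply: (@le_lt_trans _ _ r); last first.
    by apply: le_lt_trans (ler_norm r) _; rewrite ltrDl.
  apply: le_trans (coord_le_enorm u i) _; apply: le_trans ur.
  by rewrite /enorm line_pt_dot// ler_wsqrtr// lerDr sqr_ge0.
by rewrite hausdorff_cubeE// lte_mul_pinfty ?hausdorff_cube_lty// lee_fin exprn_ge0// ltW.
Qed.

Let areaE j : j \in nbr k ->
  area k j = `|dot (xi j) e|^-1 * fine (hausdorff n.+1 (S j)).
Proof.
move=> jk; rewrite /area /hmeas faceE// hausdorff_chart//; [|exact: xi1|exact: transverse].
by rewrite fineM// ge0_fin_numE// hausdorff_ge0.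
Qed.

Let hausdorff_tilted j : j \in nbr k -> hausdorff n.+1 (tilted j) = 0%E.
Proof.
move=> jk; apply/eqP; rewrite eq_le hausdorff_ge0 andbT -(normal_outward jk).
apply: (@le_trans _ _ (hausdorff n.+1 (ch j @` tilted j))); last first.
  by apply: le_hausdorff => _ [u Su <-].
have := @hausdorff_lipschitz _ _ _ _ id (ch j) 1 ltr01 n.+1 (tilted j).
rewrite expr1n mul1e image_id; apply=> u v _ _; rewrite mul1r.
by apply: chart_expanding => //; exact: transverse.
Qed.

Section on_line.
Variable u : 'rV[R]_n.+1.
Hypothesis straight : forall j, j \in nbr k -> S j u -> outward A (cell j) (xi j) (ch j u).

Let L := line_pt e u.
Let J := [seq j <- nbr k | `[< S j u >]].
Let chi t := `[< A (L t) >].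

Let LB t t' : enorm (L t - L t') = `|t - t'|.
Proof. by rewrite /enorm line_ptB// subrr dot0l addr0 sqrtr_sqr. Qed.

Let dot_LB x t t' : dot x (L t - L t') = (t - t') * dot x e.
Proof. by rewrite dotDr dotNr !dot_line_pt//; ring. Qed.

Let JP j : j \in J -> j \in nbr k /\ S j u.
Proof. by rewrite mem_filter => /andP[/asboolP Su jk]. Qed.

Let sides j : j \in J -> exists2 eps, 0 < eps & forall t, `|t - height j u| < eps ->
  ((t - height j u) * dot (xi j) e < 0 -> A (L t)) /\
  (0 < (t - height j u) * dot (xi j) e -> (cell j)° (L t) /\ ~ A (L t)).
Proof.
move=> /JP[jk Su].
have [|eps eps0 He] := outward_sides polyA _ (normal_unit jk) (straight jk Su).
  by apply: cell_disjoint; rewrite eq_sym; have /nbrP[] := jk.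
by exists eps => // t te; rewrite -dot_LB; apply: He; rewrite LB.
Qed.

Lemma sum_crossing_line :
  \sum_(j <- nbr k | `[< S j u >]) (if 0 < dot (xi j) e then 1 else -1) = 0 :> R.
Proof.
rewrite -big_filter -/J.
have [r Ar] := polytope_bounded polyA.
apply: (@sum_crossing _ _ J (height^~ u) _ chi r).
- by rewrite filter_uniq// fset_uniq.
(* Suppose two faces are crossed at the same point. Just outside face i the line is in the interior
   of cell i and outside A, whereas face j puts that point in A or in the interior of cell j. *)
- move=> i j iJ jJ /= ij; apply/eqP/negPn/negP => inj.
  have [ei ei0 Hi] := sides iJ; have [ej ej0 Hj] := sides jJ.
  have [ik Si] := JP iJ; have [jk Sj] := JP jJ.
  pose del := Num.min ei ej / 2; have del0 : 0 < del by rewrite divr_gt0// lt_min ei0.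
  have dele : del < Num.min ei ej by rewrite ltr_pdivrMr// ltr_pMr ?ltr1n// lt_min ei0.
  (* A small step past the crossing, towards the outer side of face i. *)
  pose t := height i u + del * Num.sg (dot (xi i) e).
  have ti : t - height i u = del * Num.sg (dot (xi i) e) by rewrite /t addrC addKr.
  have sg1 : `|Num.sg (dot (xi i) e)| = 1 by rewrite normr_sg transverse.
  have tn : `|t - height i u| < Num.min ei ej by rewrite ti normrM sg1 mulr1 gtr0_norm.
  move: (tn); rewrite lt_min => /andP[/Hi[_ Hi'] tj].
  have [|Bi nA] := Hi'.
    by rewrite ti -mulrA -normrEsg mulr_gt0// normr_gt0 transverse.
  rewrite ij in tj; have [Hj1 Hj2] := Hj _ tj; rewrite -ij ti in Hj1 Hj2.
  have [p|p|p] := ltgtP 0 (del * Num.sg (dot (xi i) e) * dot (xi j) e).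
  + have [Bj _] := Hj2 p; have : ((cell i)° `&` (cell j)°) (L t) by [].
    by rewrite cell_disjoint//; apply/eqP.
  + by apply: nA; exact: Hj1.
  + have : del * Num.sg (dot (xi i) e) * dot (xi j) e != 0.
      apply: mulf_neq0; last exact: transverse.
      by apply: mulf_neq0; [exact: lt0r_neq0|rewrite sgr_eq0 transverse].
    by rewrite -p eqxx.
(* A boundary point of A lies on some face, hence at a crossing. Elsewhere the line is inside the
   interior of A or inside its complement, both open. *)
- move=> t tJ; have nb : ~ boundary A (L t).
    rewrite boundary_cell => -[j /= jk Fj].
    have tE : t = height j u by apply: line_pt_plane; [|exact: transverse|exact: offsetP Fj].
    have /tJ : j \in J.
      by rewrite mem_filter jk andbT; apply/asboolP; rewrite /S /= /ch /chart -/(height j u) -tE.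
    by rewrite tE eqxx.
  have cA := polytope_closed polyA.
  have [/nbhs_enormP[eps eps0 He]|nA] := pselect (A° (L t)).
    exists eps => // t' tt'; have At : A (L t) by apply: He; rewrite subrr /enorm dot0l sqrtr0.
    rewrite /chi (asboolT At) asboolT//; apply: He; rewrite LB; exact: tt'.
  have nAt : ~ A (L t) by move=> At; apply: nb; split => //; exact: subset_closure.
  have /nbhs_enormP[eps eps0 He] : nbhs (L t) (~` A).
    by apply: open_nbhs_nbhs; split => //; exact: closed_openC.
  exists eps => // t' tt'; rewrite /chi (asboolF nAt) asboolF//; apply: He.
  by rewrite LB; exact: tt'.
- move=> j jJ; have [eps eps0 He] := sides jJ; exists eps => // t /He[H1 H2].
  have [jk _] := JP jJ; rewrite /=; split=> tj.
    have [aj|aj|/eqP] := ltgtP (dot (xi j) e) 0; last by rewrite (negbTE (transverse jk)).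
      by rewrite /chi asboolF//; apply: (H2 _).2; rewrite nmulr_rgt0// subr_lt0.
    by rewrite /chi asboolT//; apply: H1; rewrite nmulr_rlt0// subr_lt0.
  have [aj|aj|/eqP] := ltgtP (dot (xi j) e) 0; last by rewrite (negbTE (transverse jk)).
    by rewrite /chi asboolT//; apply: H1; rewrite pmulr_rlt0// subr_gt0.
  by rewrite /chi asboolF//; apply: (H2 _).2; rewrite pmulr_rgt0// subr_gt0.
- move=> t rt; apply/asboolP => /Ar; apply/negP; rewrite -ltNge; apply: lt_le_trans rt _.
  by rewrite /enorm line_pt_dot// -sqrtr_sqr ler_wsqrtr// lerDl dotvv_ge0.
Qed.

End on_line.

Let bad := \bigcup_(j in [set` nbr k]) tilted j.

Local Notation H := (@hausdorff R n.+1 n.+1 : {outer_measure set 'rV[R]_n.+1 -> \bar R}).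

Let hausdorff_bad : H bad = 0%E.
Proof.
rewrite /bad bigcup_fset big_seq; elim/big_ind: _ => [|X Y X0 Y0|j jk].
- exact: outer_measure0.
- apply/eqP; rewrite eq_le outer_measure_ge0 andbT.
  by apply: le_trans (outer_measureU2 _ _ _) _; rewrite X0 Y0 adde0.
- exact: hausdorff_tilted.
Qed.

(** Nullity of [bad] suffices for Caratheodory measurability of this set, and removing [bad] from
    every projection makes the balance of entries and exits hold at every u. *)
Let D j : set (caratheodory_type H) := S j `\` bad.

Let measurable_D j : measurable (D j).
Proof.
apply: measurableD; first exact: measurable_caratheodory.
apply: le_caratheodory_measurable => X.
rewrite [X in (X + _)%E](_ : _ = 0%E); first by rewrite add0e le_outer_measure.
apply/eqP; rewrite eq_le outer_measure_ge0 andbT -hausdorff_bad.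
by apply: le_outer_measure.
Qed.

Let hausdorff_D j : H (D j) = H (S j).
Proof.
apply/eqP; rewrite eq_le; apply/andP; split; first by apply: le_outer_measure; exact: subDsetl.
rewrite -[leRHS]adde0 -hausdorff_bad; apply: le_trans (outer_measureU2 _ _ _).
apply: le_outer_measure => u Su; have [ub|ub] := pselect (bad u); [by right|by left].
Qed.

Let sum_indic u :
  \sum_(j <- nbr k | 0 < dot (xi j) e) \1_(D j) u =
  \sum_(j <- nbr k | ~~ (0 < dot (xi j) e)) \1_(D j) u :> R.
Proof.
have [ub|ub] := pselect (bad u).
  by rewrite !big1// => j _; rewrite indicE memNset// => -[].
have DS j : \1_(D j) u = `[< S j u >]%:R :> R.
  rewrite indicE; congr ((nat_of_bool _)%:R); apply/idP/asboolP; first by rewrite inE => -[].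
  by move=> Su; rewrite inE.
have straight j : j \in nbr k -> S j u -> outward A (cell j) (xi j) (ch j u).
  by move=> jk Su; apply: contrapT => nout; apply: ub; exists j.
have := sum_crossing_line straight; rewrite (bigID (fun j => 0 < dot (xi j) e))/=.
rewrite (eq_bigr (fun=> 1)) => [|j /andP[_ ->]//].
rewrite [X in _ + X](eq_bigr (fun=> -1)) => [|j /andP[_ /negbTE ->]//].
rewrite sumrN => /eqP; rewrite subr_eq0 => /eqP cross.
have E (P : pred M) : \sum_(j <- nbr k | P j) \1_(D j) u =
    \sum_(j <- nbr k | `[< S j u >] && P j) 1 :> R.
  rewrite [RHS]big_mkcondl /=; apply: eq_bigr => j _; rewrite DS.
  by case: asboolP.
by rewrite !E.
Qed.

(** The integral over u of the balance of entries and exits: H(S j) is the area of the face times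
    |xi . e|, and the sign of xi . e tells exits from entries. *)
Lemma sum_area_dot : \sum_(j <- nbr k) area k j * dot (xi j) e = 0.
Proof.
pose mu : {measure set (caratheodory_type H) -> \bar R} := H.
have Dfin j : mu (D j) \is a fin_num.
  by rewrite ge0_fin_numE// /mu/= hausdorff_D; exact: hausdorff_S_lty.
have integral_sum (P : pred M) : (\int[mu]_u (\sum_(j <- nbr k | P j) \1_(D j) u)%:E =
    (\sum_(j <- nbr k | P j) fine (mu (D j)))%:E)%E.
  rewrite integral_sum_indic// -sumEFin; apply: eq_bigr => j _; by rewrite fineK.
have : \sum_(j <- nbr k | 0 < dot (xi j) e) fine (mu (D j)) =
    \sum_(j <- nbr k | ~~ (0 < dot (xi j) e)) fine (mu (D j)).
  apply: EFin_inj; rewrite -!integral_sum; apply: eq_integral => u _; by rewrite sum_indic.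
move=> /eqP; rewrite -subr_eq0 -sumrN => /eqP H0.
rewrite -[RHS]H0 [LHS](bigID (fun j => 0 < dot (xi j) e))/=.
congr (_ + _); rewrite big_seq_cond [RHS]big_seq_cond; apply: eq_bigr => j /andP[jk aj].
  rewrite areaE// gtr0_norm// mulrAC mulVf ?mul1r ?gt_eqF//.
  by rewrite /mu/= hausdorff_D.
rewrite -leNgt in aj.
rewrite areaE// ler0_norm// invrN mulNr mulNr mulrAC mulVf ?mul1r ?transverse//.
by rewrite /mu/= hausdorff_D.
Qed.

End closed_surface.

Lemma sum_area_normal (R : realType) n (M : mesh R n.+2) (k : M) :
  \sum_(j <- nbr k) area k j *: normal k j = 0.
Proof.
set N := \sum_(j <- nbr k) _; apply/eqP; apply: contraT => N0.
(* Including the sum N itself in the list makes N . e nonzero for a direction e transverse to all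
   faces, against [sum_area_dot]. *)
have [|v vP] := @nonorthogonal _ _ (N :: [seq normal k j | j <- nbr k]).
  move=> w; rewrite inE => /predU1P[->//|/mapP[j jk ->]].
  rewrite -dotvv_eq0; apply/eqP => nn; have := normal_unit jk.
  by rewrite /enorm nn sqrtr0 => /eqP; rewrite eq_sym oner_eq0.
have v0 : enorm v != 0.
  apply/eqP => /eqP; rewrite sqrtr_eq0 => vv.
  have /eqP : dot v v = 0 by apply/eqP; rewrite eq_le vv dotvv_ge0.
  rewrite dotvv_eq0 => /eqP v0; have := vP N; rewrite inE eqxx => /(_ isT).
  by rewrite v0 dotC dot0l eqxx.
pose e := (enorm v)^-1 *: v.
have e1 : dot e e = 1.
  by rewrite !dotE -[dot v v]sqr_sqrtr ?dotvv_ge0// -/(enorm v); field.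
have := @sum_area_dot _ _ M k e e1 _.
have -> : \sum_(j <- nbr k) area k j * dot (normal k j) e = dot N e.
  by rewrite dot_suml; apply: eq_bigr => j _; rewrite dotZl.
have Ne : dot N e != 0 by rewrite dotZr mulf_neq0 ?invr_eq0// vP// inE eqxx.
move=> Ne0; move: Ne; rewrite Ne0 ?eqxx// => j jk.
rewrite dotZr mulf_neq0 ?invr_eq0// vP// inE; apply/orP; right; exact: map_f.
Qed.

Theorem theorem3p3 (R : realType) (d : nat) (hd : d = 2%N \/ d = 3%N)
    (h : R -> R -> R) (heos : is_eos h)
    (M : mesh R d) (K Q : nat)
    (w : 'I_Q -> R) (x : M -> M -> 'I_Q -> 'rV[R]_d)
    (hquad : quadrature K w x)
    (alpha dt : R) (halpha : 1 <= alpha) (hdt : 0 < dt)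
    (U : M -> 'rV[R]_d -> state R)
    (hU : forall k i, polynomial_fun K (fun y => U k y 0 i))
    (Ubar Ubar1 : M -> state R)
    (havg : forall k, Ubar k = cell_average U k)
    (hscheme : forall k, Ubar1 k = next_average h w x U alpha dt Ubar k)
    (hdiv : forall k, divB w x U k = 0)
    (hadm : forall k j mu, j \in nbr k -> admissible h (U k (x k j mu)))
    (beta : M -> R) (hbeta : forall k, 0 < beta k < 2^-1)
    (hW : forall k, admissible h (inner_state w x U Ubar beta k)) :
  forall k, 0 < alpha * dt / (2 * vol k) * perimeter k < beta k ->
    admissible h (Ubar1 k).
Proof.
move=> k cfl; rewrite hscheme.
have d3 : (d <= 3)%N by case: hd => ->.
apply: (next_average_admissible d3 heos hquad hadm halpha hdiv hW (hbeta k) _ cfl).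
by case: hd => dE; subst d; exact: sum_area_normal.
Qed.
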